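(* Let $I$ be a proper ideal in a Noetherian local ring $R$ with completion $R^*$. Then the following hold: (i) $\operatorname{qacogd}(I)\le\dim R/I$. (ii) $\operatorname{qacogd}(I)\ge\min\{\dim R^*/\mathfrak q\mid\mathfrak q\in\overline{Q^*}(IR^* )\}$.
   Context: All rings are commutative Noetherian with nonzero identity. For a prime ideal $\mathfrak p$ of a ring $R$, $R_{\mathfrak p}^*$ denotes the completion of the local ring $R_{\mathfrak p}$. A prime $\mathfrak p$ is a quintasymptotic prime of an ideal $I$ of $R$ if there is a minimal prime $z$ of $R_{\mathfrak p}^*$ with $\operatorname{Rad}(IR_{\mathfrak p}^*+z)=\mathfrak pR_{\mathfrak p}^*$; the set of these is $\overline{Q^*}(I)$. A sequence $x_1,\dots,x_n$ of elements of $R$ is a quintasymptotic sequence over $I$ if $(I,(x_1,\dots,x_n))\ne R$ and, for all $1\le i\le n$, $x_i$ lies in no prime of $\overline{Q^*}((I,(x_1,\dots,x_{i-1})))$; the empty sequence is allowed when $I\neq R$. It is maximal if it cannot be extended to such a sequence by any $x_{n+1}\in R$. For $R$ local and $I$ proper, $\operatorname{qacogd}(I)$ is the common length of all maximal quintasymptotic sequences over $I$ (known to be well defined). *)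

(* Defs.v *)
(* Based on the Mathematical Components library, with mathcomp.classical for
   sets and classical reasoning. *)
From HB Require Import structures.
From mathcomp Require Import all_boot all_order all_algebra.
From mathcomp Require Import generic_quotient ring_quotient ring.
From mathcomp Require Import boolp classical_sets functions.
From mathcomp Require Import constructive_ereal.

Set Implicit Arguments.
Unset Strict Implicit.
Unset Printing Implicit Defensive.

Import Order.TTheory GRing.Theory.

Local Open Scope ring_scope.
Local Open Scope classical_set_scope.
Local Open Scope quotient_scope.

(* Ideals that are allowed to be improper are classical sets satisfying
   [is_ideal]; proper ideals and primes are MathComp's bundled [idealr R]
   and [prime_idealr R]. *)

Section Ideals.
Variable R : comNzRingType.
Implicit Types (A J K : set R).

Definition is_ideal J : Prop :=
  J 0 /\ forall a x y, J x -> J y -> J (a * x + y).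

Definition ideal_span A : set R := smallest is_ideal A.

Definition ideal_add J K : set R := [set x + y | x in J & y in K].

Definition ideal_mul J K : set R := ideal_span [set x * y | x in J & y in K].

Definition ideal_exp J (k : nat) : set R := iter k (ideal_mul J) setT.

Definition radical J : set R := [set x | exists k : nat, J (x ^+ k)].

Definition noetherian : Prop :=
  forall J, is_ideal J -> exists s : seq R, J = ideal_span [set` s].

Definition maximal_ideal (M : idealr R) : Prop :=
  forall J : idealr R, {subset M <= J} -> {subset J <= M}.

Definition local_ring (M : idealr R) : Prop :=
  maximal_ideal M /\ forall N : idealr R, maximal_ideal N -> N =i M.

Definition minimal_prime (z : prime_idealr R) : Prop :=
  forall z' : prime_idealr R, {subset z' <= z} -> {subset z <= z'}.

(* Supremum, in the integers extended with infinities, of the lengths n of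
   the chains c 0 < ... < c n of primes. *)
Definition krull_dim : \bar int :=
  supremum -oo%E
    [set (n%:Z)%:E | n in [set n : nat | exists c : 'I_n.+1 -> prime_idealr R,
       forall i j : 'I_n.+1, (i < j)%N -> [set` c i] `<` [set` c j]]].

Lemma ideal_span_ideal A : is_ideal (ideal_span A).
Proof.
split=> [J [[J0 _] _] //|a x y Ax Ay J [idJ AJ]].
by apply: idJ.2; [apply: Ax|apply: Ay].
Qed.

Lemma sub_ideal_span A : A `<=` ideal_span A.
Proof. by move=> x Ax J [_]; apply. Qed.

Lemma ideal_span_min A J : is_ideal J -> A `<=` J -> ideal_span A `<=` J.
Proof. by move=> idJ AJ x; apply. Qed.

Lemma ideal0 J : is_ideal J -> J 0. Proof. by case. Qed.

Lemma idealD J x y : is_ideal J -> J x -> J y -> J (x + y).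
Proof. by move=> idJ Jx Jy; rewrite -[x]mul1r; apply: idJ.2. Qed.

Lemma idealM J a x : is_ideal J -> J x -> J (a * x).
Proof.
by move=> idJ Jx; rewrite -[a * x]addr0; apply: idJ.2 => //; case: idJ.
Qed.

Lemma idealN J x : is_ideal J -> J x -> J (- x).
Proof. by move=> idJ Jx; rewrite -mulN1r; apply: idealM. Qed.

Lemma ideal_exp_ideal J k : is_ideal (ideal_exp J k).
Proof. by case: k => [|k]; [split|apply: ideal_span_ideal]. Qed.

Lemma idealr_is_ideal (I : idealr R) : is_ideal [set` I].
Proof.
split=> [|a x y] /=; first exact: idealr0.
by move=> Ix Iy; rewrite rpredD ?idealMr.
Qed.

Lemma ideal_exp1_sub (I : idealr R) : ideal_exp [set` I] 1 `<=` [set` I].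
Proof.
apply: ideal_span_min; first exact: idealr_is_ideal.
by move=> _ [x Ix [y _ <-]]; rewrite /= mulrC; apply: idealMr.
Qed.

End Ideals.

Definition ideal_ext (R S : comNzRingType) (f : {rmorphism R -> S})
  (J : set R) : set S := ideal_span (f @` J).

(* The I-adic completion: Cauchy sequences modulo null sequences. *)

Section Completion.
Variables (R : comNzRingType) (I : idealr R).

Definition is_cauchy (u : nat -> R) : Prop :=
  forall k : nat, exists N : nat, forall i j : nat,
    (N <= i)%N -> (N <= j)%N -> ideal_exp [set` I] k (u i - u j).

Definition is_null (u : nat -> R) : Prop :=
  forall k : nat, exists N : nat, forall i : nat,
    (N <= i)%N -> ideal_exp [set` I] k (u i).

Definition cauchy_pred : {pred nat -> R} := fun u => `[< is_cauchy u >].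

Lemma cauchyP u : reflect (is_cauchy u) (u \in cauchy_pred).
Proof. exact: asboolP. Qed.

Lemma cauchy_subring_closed : subring_closed cauchy_pred.
Proof.
split=> [|u v /cauchyP cu /cauchyP cv|u v /cauchyP cu /cauchyP cv];
  apply/cauchyP => k.
- by exists 0%N => i j _ _; rewrite subrr; exact: ideal0 (ideal_exp_ideal _ _).
- have [M uM] := cu k; have [N vN] := cv k.
  exists (maxn M N) => i j; rewrite !geq_max => /andP[Mi Ni] /andP[Mj Nj].
  rewrite (_ : _ - _ = (u i - u j) + - (v i - v j)); last first.
    by rewrite !fctE; ring.
  have id := @ideal_exp_ideal R [set` I] k.
  by apply: (idealD id); [apply: uM|apply: (idealN id); exact: vN].
- have [M uM] := cu k; have [N vN] := cv k.
  exists (maxn M N) => i j; rewrite !geq_max => /andP[Mi Ni] /andP[Mj Nj].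
  rewrite (_ : _ - _ = u i * (v i - v j) + v j * (u i - u j)); last first.
    by rewrite !fctE; ring.
  have id := @ideal_exp_ideal R [set` I] k.
  by apply: (idealD id); apply: (idealM _ id); [apply: vN|apply: uM].
Qed.

HB.instance Definition _ :=
  GRing.isSubringClosed.Build (nat -> R) cauchy_pred cauchy_subring_closed.

Record cauchy_seq := CauchySeq {
  cauchy_fun :> nat -> R;
  cauchy_funP : cauchy_fun \in cauchy_pred }.

HB.instance Definition _ := [isSub for cauchy_fun].
HB.instance Definition _ := [Choice of cauchy_seq by <:].
HB.instance Definition _ := [SubChoice_isSubComNzRing of cauchy_seq by <:].

Definition null_pred : {pred cauchy_seq} := fun u => `[< is_null u >].

Lemma nullP (u : cauchy_seq) : reflect (is_null u) (u \in null_pred).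
Proof. exact: asboolP. Qed.

Lemma null_idealr_closed : idealr_closed null_pred.
Proof.
split=> [||a u v /nullP nu /nullP nv].
- by apply/nullP => k; exists 0%N => i _; exact: ideal0 (ideal_exp_ideal _ _).
- apply/nullP => /(_ 1%N) [N /(_ N (leqnn N))].
  by move=> /ideal_exp1_sub; rewrite /= (idealr1 I).
- apply/nullP => k; have [M uM] := nu k; have [N vN] := nv k.
  exists (maxn M N) => i; rewrite geq_max => /andP[Mi Ni].
  exact: (ideal_exp_ideal _ _).2 (uM i Mi) (vN i Ni).
Qed.

HB.instance Definition _ :=
  isIdealr.Build cauchy_seq null_pred null_idealr_closed.

Definition completion : comNzRingType := {ideal_quot null_pred}.

Lemma const_cauchy (x : R) : (fun=> x) \in cauchy_pred.
Proof.
apply/cauchyP => k; exists 0%N => i j _ _; rewrite subrr.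
exact: ideal0 (ideal_exp_ideal _ _).
Qed.

Definition to_completion (x : R) : completion :=
  \pi_({ideal_quot null_pred}) (CauchySeq (const_cauchy x)).

Lemma to_completion_zmod_morphism : zmod_morphism to_completion.
Proof.
by move=> x y; rewrite /to_completion -rmorphB; congr (\pi _); apply: val_inj.
Qed.

Lemma to_completion_monoid_morphism : monoid_morphism to_completion.
Proof.
split=> [|x y]; rewrite /to_completion.
  rewrite -(rmorph1 \pi_({ideal_quot null_pred})).
  by congr (\pi _); apply: val_inj.
by rewrite -rmorphM; congr (\pi _); apply: val_inj.
Qed.

HB.instance Definition _ := GRing.isZmodMorphism.Build R completion to_completion
  to_completion_zmod_morphism.
HB.instance Definition _ := GRing.isMonoidMorphism.Build R completion to_completion
  to_completion_monoid_morphism.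

End Completion.

Section Localization.
Variables (R : comNzRingType) (p : prime_idealr R).

Definition denom : Type := {s : R | s \notin p}.

HB.instance Definition _ := SubChoice.on denom.

Lemma denom1_subproof : (1 : R) \notin p. Proof. by rewrite idealr1. Qed.

Lemma denomM_subproof (s t : denom) : sval s * sval t \notin p.
Proof. by rewrite prime_idealrM negb_or (valP s) (valP t). Qed.

Definition denom1 : denom := exist (fun x : R => x \notin p) 1 denom1_subproof.
Definition denomM (s t : denom) : denom :=
  exist (fun x : R => x \notin p) _ (denomM_subproof s t).

(* The pair (a, s) stands for the fraction a / s. *)
Definition loc_eq (x y : R * denom) : bool :=
  `[< exists u : denom, sval u * (x.1 * sval y.2) = sval u * (y.1 * sval x.2) >].

Lemma loc_eq_refl : reflexive loc_eq.
Proof. by move=> x; apply/asboolP; exists denom1. Qed.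

Lemma loc_eq_sym : symmetric loc_eq.
Proof.
by move=> x y; apply/asboolP/asboolP => -[u xy]; exists u; rewrite xy.
Qed.

Lemma loc_eq_trans : transitive loc_eq.
Proof.
move=> y x z /asboolP[u xy] /asboolP[v yz]; apply/asboolP.
exists (denomM (denomM u v) y.2) => /=.
transitivity (sval v * sval z.2 * (sval u * (x.1 * sval y.2))); first by ring.
rewrite xy.
transitivity (sval u * sval x.2 * (sval v * (y.1 * sval z.2))); first by ring.
by rewrite yz; ring.
Qed.

Canonical loc_equiv := EquivRel loc_eq loc_eq_refl loc_eq_sym loc_eq_trans.

Definition localization : Type := {eq_quot loc_eq}.

HB.instance Definition _ : EqQuotient _ loc_eq localization :=
  EqQuotient.on localization.
HB.instance Definition _ := Choice.on localization.

Local Notation pi := (\pi_localization).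

Lemma loc_piP x y : pi x = pi y <->
  exists u : denom, sval u * (x.1 * sval y.2) = sval u * (y.1 * sval x.2).
Proof. by split=> [/eqmodP/asboolP|?]; last apply/eqmodP/asboolP. Qed.

Lemma loc_reprP x : exists u : denom,
  sval u * ((repr (pi x)).1 * sval x.2) = sval u * (x.1 * sval (repr (pi x)).2).
Proof. by apply/loc_piP; rewrite reprK. Qed.

Definition loc_add0 (x y : R * denom) : R * denom :=
  (x.1 * sval y.2 + y.1 * sval x.2, denomM x.2 y.2).
Definition loc_opp0 (x : R * denom) : R * denom := (- x.1, x.2).
Definition loc_mul0 (x y : R * denom) : R * denom :=
  (x.1 * y.1, denomM x.2 y.2).

Definition loc_zero : localization := pi (0, denom1).
Definition loc_one : localization := pi (1, denom1).
Definition loc_add := lift_op2 localization loc_add0.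
Definition loc_opp := lift_op1 localization loc_opp0.
Definition loc_mul := lift_op2 localization loc_mul0.

Lemma loc_addE x y : loc_add (pi x) (pi y) = pi (loc_add0 x y).
Proof.
unlock loc_add; apply/loc_piP; have [u xu] := loc_reprP x; have [v yv] := loc_reprP y.
move: (repr (pi x)) (repr (pi y)) xu yv => x' y' xu yv.
exists (denomM u v) => /=.
transitivity (sval v * sval y'.2 * sval y.2 * (sval u * (x'.1 * sval x.2))
  + sval u * sval x'.2 * sval x.2 * (sval v * (y'.1 * sval y.2))); first by ring.
by rewrite xu yv; ring.
Qed.

Lemma loc_oppE x : loc_opp (pi x) = pi (loc_opp0 x).
Proof.
unlock loc_opp; apply/loc_piP; have [u xu] := loc_reprP x.
by exists u => /=; rewrite !mulNr !mulrN xu.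
Qed.

Lemma loc_mulE x y : loc_mul (pi x) (pi y) = pi (loc_mul0 x y).
Proof.
unlock loc_mul; apply/loc_piP; have [u xu] := loc_reprP x; have [v yv] := loc_reprP y.
move: (repr (pi x)) (repr (pi y)) xu yv => x' y' xu yv.
exists (denomM u v) => /=.
transitivity ((sval u * (x'.1 * sval x.2)) * (sval v * (y'.1 * sval y.2))).
  by ring.
by rewrite xu yv; ring.
Qed.

Let locE := (loc_addE, loc_oppE, loc_mulE).

Lemma loc_addA : associative loc_add.
Proof.
elim/quotW=> x; elim/quotW=> y; elim/quotW=> z; rewrite !locE.
by apply/loc_piP; exists denom1 => /=; ring.
Qed.

Lemma loc_addC : commutative loc_add.
Proof.
elim/quotW=> x; elim/quotW=> y; rewrite !locE.
by apply/loc_piP; exists denom1 => /=; ring.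
Qed.

Lemma loc_add0l : left_id loc_zero loc_add.
Proof.
elim/quotW=> x; rewrite !locE.
by apply/loc_piP; exists denom1 => /=; ring.
Qed.

Lemma loc_addN : left_inverse loc_zero loc_opp loc_add.
Proof.
elim/quotW=> x; rewrite !locE.
by apply/loc_piP; exists denom1 => /=; ring.
Qed.

Lemma loc_mulA : associative loc_mul.
Proof.
elim/quotW=> x; elim/quotW=> y; elim/quotW=> z; rewrite !locE.
by apply/loc_piP; exists denom1 => /=; ring.
Qed.

Lemma loc_mulC : commutative loc_mul.
Proof.
elim/quotW=> x; elim/quotW=> y; rewrite !locE.
by apply/loc_piP; exists denom1 => /=; ring.
Qed.

Lemma loc_mul1 : left_id loc_one loc_mul.
Proof.
elim/quotW=> x; rewrite !locE.
by apply/loc_piP; exists denom1 => /=; ring.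
Qed.

Lemma loc_mulDl : left_distributive loc_mul loc_add.
Proof.
elim/quotW=> x; elim/quotW=> y; elim/quotW=> z; rewrite !locE.
by apply/loc_piP; exists denom1 => /=; ring.
Qed.

Lemma loc_one_neq0 : loc_one != loc_zero.
Proof.
apply/eqP => /loc_piP[u /=]; rewrite !mulr1 mulr0 => u0.
by have /= := valP u; rewrite u0 idealr0.
Qed.

HB.instance Definition _ :=
  GRing.isZmodule.Build localization loc_addA loc_addC loc_add0l loc_addN.
HB.instance Definition _ := GRing.Zmodule_isComNzRing.Build localization
  loc_mulA loc_mulC loc_mul1 loc_mulDl loc_one_neq0.

Definition to_loc (x : R) : localization := pi (x, denom1).

Lemma to_loc_zmod_morphism : zmod_morphism to_loc.
Proof.
move=> x y; rewrite /to_loc -[RHS]/(loc_add _ (loc_opp _)) !locE.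
by apply/loc_piP; exists denom1 => /=; ring.
Qed.

Lemma to_loc_monoid_morphism : monoid_morphism to_loc.
Proof.
split=> // x y; rewrite /to_loc -[RHS]/(loc_mul _ _) !locE.
by apply/loc_piP; exists denom1 => /=; ring.
Qed.

HB.instance Definition _ :=
  GRing.isZmodMorphism.Build R localization to_loc to_loc_zmod_morphism.
HB.instance Definition _ :=
  GRing.isMonoidMorphism.Build R localization to_loc to_loc_monoid_morphism.

Definition loc_max : {pred localization} :=
  fun x => `[< ideal_ext to_loc [set` p] x >].

Lemma loc_maxP x : reflect (ideal_ext to_loc [set` p] x) (x \in loc_max).
Proof. exact: asboolP. Qed.

Lemma loc_max_frac x : ideal_ext to_loc [set` p] x ->
  exists a (s : denom), a \in p /\ x = pi (a, s).
Proof.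
pose J : set localization :=
  [set x | exists a (s : denom), a \in p /\ x = pi (a, s)].
apply: (@ideal_span_min _ _ J) => [|_ [a pa <-]]; last by exists a, denom1.
split=> [|a _ _ [b [s [pb ->]]] [c [t [pc ->]]]].
  by exists 0, denom1; rewrite idealr0.
elim/quotW: a => -[a r]; exists (a * b * sval t + c * (sval r * sval s)).
exists (denomM (denomM r s) t); split.
  by rewrite rpredD // mulrC idealMr // ?idealMr // mulrC idealMr.
by rewrite -[LHS]/(loc_add (loc_mul _ _) _) !locE.
Qed.

Lemma loc_max_idealr_closed : idealr_closed loc_max.
Proof.
have id := @ideal_span_ideal _ (to_loc @` [set` p]).
split=> [||a x y /loc_maxP mx /loc_maxP my].
  by apply/loc_maxP; exact: ideal0 id.
  apply/loc_maxP => /loc_max_frac[a [s [pa /loc_piP[u /= e]]]].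
  move: e; rewrite mul1r mulr1 => e.
  have : sval (denomM u s) \in p by rewrite /= e idealMr.
  by apply/negP; exact: proj2_sig (denomM u s).
by apply/loc_maxP; exact: id.2.
Qed.

HB.instance Definition _ :=
  isIdealr.Build localization loc_max loc_max_idealr_closed.

(* The completion of the local ring at p. *)
Definition loc_completion : comNzRingType := completion loc_max.

Definition to_loc_completion : {rmorphism R -> loc_completion} :=
  to_completion loc_max \o to_loc.

End Localization.

Section Quintasymptotic.
Variable R : comNzRingType.
Implicit Types (J : set R) (s : seq R).

(* p belongs to the set Q^*-bar(J) of quintasymptotic primes of J.  This is a
   predicate and not a [set (prime_idealr R)] because the latter makes the
   universe constraints inconsistent. *)
Definition quint_prime J (p : prime_idealr R) : Prop :=
  exists2 z : prime_idealr (loc_completion p), minimal_prime z &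
    radical (ideal_add (ideal_ext (to_loc_completion p) J) [set` z])
      = ideal_ext (to_loc_completion p) [set` p].

Definition ideal_adjoin J s : set R := ideal_span (J `|` [set` s]).

Definition quint_seq J s : Prop :=
  ideal_adjoin J s <> setT /\
  forall (i : nat) (p : prime_idealr R), (i < size s)%N ->
    quint_prime (ideal_adjoin J (take i s)) p -> s`_i \notin p.

Definition maximal_quint_seq J s : Prop :=
  quint_seq J s /\ forall y : R, ~ quint_seq J (rcons s y).

(* When R is a Noetherian local ring and J a proper ideal, all maximal
   quintasymptotic sequences over J have the same length, so [xget] picks
   from a singleton; the default value 0 is then irrelevant. *)
Definition qacogd J : nat :=
  xget 0%N [set size s | s in maximal_quint_seq J].

End Quintasymptotic.

Definition is_min (A : set (\bar int)) (d : \bar int) : Prop :=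
  A d /\ lbound A d.

(* Main.v *)
Require Import Defs.
From HB Require Import structures.
From mathcomp Require Import all_boot all_order all_algebra.
From mathcomp Require Import generic_quotient ring_quotient ring zify.
From mathcomp Require Import boolp classical_sets constructive_ereal.
From Stdlib Require List.

(** Write [J_i] for the ideal generated by [I] and the first [i] terms of a
    quintasymptotic sequence of length [n].

    Upper bound.  A prime [p] minimal over an ideal [J] belongs to [Q^*(J)]: in
    the completion of the localization at [p] the ideal [J] is already primary to
    the maximal ideal, so any minimal prime of that completion is a witness
    ([min_prime_quint]).  Hence each term of the sequence avoids the minimal
    primes over the ideal generated before it; going down from the maximal ideal,
    one finds a chain of [n] strict inclusions of primes over [I]
    ([quint_seq_chain]).

    Lower bound.  The point is that for a maximal sequence the maximal ideal [m]
    belongs to [Q^*(J_n)] ([maximal_quint_seq_top]).  Otherwise the sequence is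
    extended by some [y] in [m] outside of all primes of [Q^*(J_n)], found as
    follows.  The associated graded ring of [J_n] is a quotient of a Noetherian
    ring, the Rees algebra; decomposing an ideal of it into irreducible ones and
    avoiding the finitely many radicals that do not contain [m] gives a [y] such
    that [y * a] in [J_n ^ k] forces [a] into [J_n ^ k] up to a power of each
    member of [m] ([power_torsion_avoidance]).  Locally at a prime [p] different
    from [m], such a [y] is regular modulo every power of [J_n].  If [p] contained
    [y] and belonged to [Q^*(J_n)], some nonzero [c] in the completion at [p]
    would satisfy [y ^ (T k) * c] in [J_n ^ k] for all [k]; regularity and the
    Artin-Rees lemma would put [c] into every power of the maximal ideal, so that
    [c = 0] ([regular_not_quint]).

    Let [A] be the completion of the local ring.  Thus there is a minimal prime
    [z] of [A] such that [J_n A + z] is primary to the maximal ideal.  A prime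
    [q] minimal over [I A + z] belongs to [Q^*(I A)], for some minimal prime of
    the completion of [A] at [q] lies over [z], by Krull's intersection theorem
    ([min_prime_lift], [quint_prime_of_min]).  Modulo [q] the maximal ideal is
    the radical of an ideal with [n] generators, so Krull's height theorem gives
    [dim A / q <= n] ([maximal_quint_seq_dim]).

    This uses that [A] is a Noetherian local ring.  Like the Artin-Rees lemma,
    this is deduced from the finite generation of the graded ideals of the Rees
    algebra ([graded_stable]), applied to initial forms
    ([noetherian_completion]). *)

Set Implicit Arguments.
Unset Strict Implicit.
Unset Printing Implicit Defensive.
Import Order.TTheory GRing.Theory.
Local Open Scope ring_scope.
Local Open Scope classical_set_scope.
Local Open Scope quotient_scope.

(** * Ideals and primes *)

Section IdealBasics.
Variable R : comNzRingType.
Implicit Types (J K L P : set R).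

Lemma is_idealMr J a x : is_ideal J -> J x -> J (x * a).
Proof. by rewrite mulrC; apply: idealM. Qed.

Lemma idealB J x y : is_ideal J -> J x -> J y -> J (x - y).
Proof. by move=> iJ Jx Jy; apply: idealD => //; apply: idealN. Qed.

Lemma idealBr J x y : is_ideal J -> J (x - y) -> J y -> J x.
Proof. by move=> iJ Jxy Jy; rewrite -(subrK y x); apply: idealD. Qed.

Lemma ideal1 J : is_ideal J -> J 1 -> J = setT.
Proof.
move=> iJ J1; apply/seteqP; split=> // x _; rewrite -[x]mulr1; exact: idealM.
Qed.

Lemma ideal_sum J (I : Type) (r : seq I) (Q : pred I) (F : I -> R) :
  is_ideal J -> (forall i, Q i -> J (F i)) -> J (\sum_(i <- r | Q i) F i).
Proof.
by move=> iJ JF; elim/big_ind: _ => //; [case: iJ | move=> x y; apply: idealD].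
Qed.

Lemma is_idealP J : J 0 -> (forall x y, J x -> J y -> J (x + y)) ->
  (forall a x, J x -> J (a * x)) -> is_ideal J.
Proof. by move=> J0 JD JM; split=> // a x y Jx Jy; apply: JD => //; apply: JM. Qed.

Lemma zero_ideal : is_ideal [set 0 : R].
Proof. by split=> // a x y -> ->; rewrite mulr0 addr0. Qed.

Lemma principal_ideal (v : R) : is_ideal [set r * v | r in setT].
Proof.
apply: is_idealP; first by exists 0 => //; rewrite mul0r.
  by move=> _ _ [r _ <-] [r' _ <-]; exists (r + r') => //; rewrite mulrDl.
by move=> c _ [r _ <-]; exists (c * r) => //; rewrite mulrA.
Qed.

Lemma ideal_add_ideal J K : is_ideal J -> is_ideal K -> is_ideal (ideal_add J K).
Proof.
move=> iJ iK; apply: is_idealP.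
- by exists 0; [case: iJ | exists 0; [case: iK | rewrite addr0]].
- move=> _ _ [x Jx [y Ky <-]] [x' Jx' [y' Ky' <-]].
  exists (x + x'); first exact: idealD.
  by exists (y + y'); [exact: idealD | rewrite addrACA].
- move=> a _ [x Jx [y Ky <-]]; exists (a * x); first exact: idealM.
  by exists (a * y); [exact: idealM | rewrite mulrDr].
Qed.

Lemma ideal_addl J K : is_ideal K -> J `<=` ideal_add J K.
Proof. by case=> K0 _ x Jx; exists x => //; exists 0 => //; rewrite addr0. Qed.

Lemma ideal_addr J K : is_ideal J -> K `<=` ideal_add J K.
Proof. by case=> J0 _ x Kx; exists 0 => //; exists x => //; rewrite add0r. Qed.

Lemma ideal_add_min J K L : is_ideal L -> J `<=` L -> K `<=` L ->
  ideal_add J K `<=` L.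
Proof. by move=> iL JL KL _ [x /JL Lx [y /KL Ly <-]]; apply: idealD. Qed.

Lemma ideal_span_sub (A B : set R) : A `<=` B -> ideal_span A `<=` ideal_span B.
Proof.
move=> AB; apply: ideal_span_min; first exact: ideal_span_ideal.
by move=> x /AB; apply: sub_ideal_span.
Qed.

Lemma ideal_mul_ideal J K : is_ideal (ideal_mul J K).
Proof. exact: ideal_span_ideal. Qed.

Lemma ideal_mulM J K x y : J x -> K y -> ideal_mul J K (x * y).
Proof. by move=> Jx Ky; apply: sub_ideal_span; exists x => //; exists y. Qed.

Lemma ideal_mul_min J K L : is_ideal L ->
  (forall x y, J x -> K y -> L (x * y)) -> ideal_mul J K `<=` L.
Proof.
move=> iL JKL; apply: ideal_span_min => // _ [x Jx [y Ky <-]]; exact: JKL.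
Qed.

Lemma ideal_mul_sub J K J' K' : J `<=` J' -> K `<=` K' ->
  ideal_mul J K `<=` ideal_mul J' K'.
Proof.
move=> JJ KK; apply: ideal_mul_min; first exact: ideal_mul_ideal.
by move=> x y /JJ Jx /KK Ky; apply: ideal_mulM.
Qed.

Lemma ideal_mulSr J K : is_ideal K -> ideal_mul J K `<=` K.
Proof. by move=> iK; apply: ideal_mul_min => // x y _; apply: idealM. Qed.

Lemma ideal_expD J i j x y :
  ideal_exp J i x -> ideal_exp J j y -> ideal_exp J (i + j) (x * y).
Proof.
move=> + Jy; elim: i x => [|i IH] x.
  by move=> _; apply: idealM => //; apply: ideal_exp_ideal.
have iJ := @ideal_exp_ideal R J (i.+1 + j).
pose L := [set x | ideal_exp J (i.+1 + j) (x * y)].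
suff: ideal_exp J i.+1 `<=` L by apply.
apply: ideal_mul_min => [|a b Ja Jb].
  split; rewrite /L /=; first by rewrite mul0r; case: iJ.
  by move=> a u v Lu Lv; rewrite mulrDl -mulrA; apply: iJ.2.
by rewrite /L /= -mulrA; apply: ideal_mulM => //; apply: IH.
Qed.

Lemma ideal_expX J k x : J x -> ideal_exp J k (x ^+ k).
Proof. by move=> Jx; elim: k => // k IH; rewrite exprS; apply: ideal_mulM. Qed.

Lemma ideal_expS_sub J k : ideal_exp J k.+1 `<=` ideal_exp J k.
Proof. by apply: ideal_mulSr; apply: ideal_exp_ideal. Qed.

Lemma ideal_exp_le J k l : (k <= l)%N -> ideal_exp J l `<=` ideal_exp J k.
Proof.
move=> /subnK <-; elim: (l - k)%N => // n IH x Jx; apply: IH.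
exact: ideal_expS_sub.
Qed.

Lemma ideal_exp_sub J K k : J `<=` K -> ideal_exp J k `<=` ideal_exp K k.
Proof. by move=> JK; elim: k => // k IH; apply: ideal_mul_sub. Qed.

Lemma ideal_exp1 J : is_ideal J -> ideal_exp J 1 = J.
Proof.
move=> iJ; apply/seteqP; split.
  by apply: ideal_mul_min => // x y Jx _; apply: is_idealMr.
by move=> x Jx; rewrite -[x]mulr1; apply: ideal_mulM.
Qed.

(** Control on the coefficients is what makes successive approximations converge
    below: they are small when [J] is a high power. *)
Lemma ideal_mul_span J (s : seq R) x : is_ideal J ->
  ideal_mul J (ideal_span [set` s]) x ->
  exists2 c : nat -> R, forall i, J (c i) & x = \sum_(i < size s) c i * s`_i.
Proof.
move=> iJ.
pose L := [set x | exists2 c : nat -> R, forall i, J (c i) &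
  x = \sum_(i < size s) c i * s`_i].
suff: ideal_mul J (ideal_span [set` s]) `<=` L by apply.
have iL : is_ideal L.
  apply: is_idealP.
  - exists (fun=> 0) => [i|]; first by case: iJ.
    by rewrite big1 // => i _; rewrite mul0r.
  - move=> _ _ [c Jc ->] [c' Jc' ->]; exists (fun i => c i + c' i).
      by move=> i; apply: idealD.
    by rewrite -big_split; apply: eq_bigr => i _; rewrite mulrDl.
  - move=> a _ [c Jc ->]; exists (fun i => a * c i).
      by move=> i; apply: idealM.
    by rewrite mulr_sumr; apply: eq_bigr => i _; rewrite mulrA.
apply: ideal_mul_min => // a y Ja; move: y.
apply: ideal_span_min => [|y /= ys].
  split=> [|b u v]; rewrite /= ?mulr0; first by case: iL.
  by move=> Lu Lv; rewrite mulrDr mulrCA; apply: iL.2.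
exists (fun i => if i == index y s then a else 0).
  by move=> i; case: ifP => // _; case: iJ.
have lt : (index y s < size s)%N by rewrite index_mem.
rewrite (bigD1 (Ordinal lt)) //= eqxx nth_index // big1 ?addr0 // => i.
by rewrite -val_eqE /= => /negbTE ->; rewrite mul0r.
Qed.

Lemma ideal_span_seqP (s : seq R) x :
  ideal_span [set` s] x -> exists c : nat -> R, x = \sum_(i < size s) c i * s`_i.
Proof.
move=> sx; have [//||c _ ->] := @ideal_mul_span setT s x; last by exists c.
by rewrite -[x]mul1r; apply: ideal_mulM.
Qed.

Lemma ideal_adjoin_ideal J (s : seq R) : is_ideal (ideal_adjoin J s).
Proof. exact: ideal_span_ideal. Qed.

Lemma ideal_adjoin_sub J (s : seq R) : J `<=` ideal_adjoin J s.
Proof. by move=> x Jx; apply: sub_ideal_span; left. Qed.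

Lemma ideal_adjoin_mem J (s : seq R) x : x \in s -> ideal_adjoin J s x.
Proof. by move=> sx; apply: sub_ideal_span; right. Qed.

End IdealBasics.

Section Primes.
Variable R : comNzRingType.
Implicit Types (J K L P Q T : set R).

Definition is_prime P : Prop :=
  [/\ is_ideal P, ~ P 1 & forall a b, P (a * b) -> P a \/ P b].

Lemma primeX P a k : is_prime P -> P (a ^+ k) -> P a.
Proof.
by move=> [_ P1 PM]; elim: k => // k IH; rewrite exprS => /PM[].
Qed.

Lemma prime_idealr_is_prime (p : prime_idealr R) : is_prime [set` p].
Proof.
split; first exact: idealr_is_ideal.
  by rewrite /= idealr1.
by move=> a b /=; rewrite prime_idealrM => /orP.
Qed.

Lemma prime_idealr_of P : is_prime P -> exists p : prime_idealr R, [set` p] = P.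
Proof.
move=> [iP P1 PM]; pose S : {pred R} := fun x => `[< P x >].
have cS : idealr_closed S.
  split=> [||a x y /asboolP Px /asboolP Py]; first by apply/asboolP; case: iP.
    by apply/asboolP.
  by apply/asboolP; apply: iP.2.
have pS : prime_idealr_closed S.
  by move=> u v /asboolP/PM[] ?; apply/orP; [left|right]; apply/asboolP.
pose H1 := isIdealr.Build R S cS.
pose I1 : idealr R := HB.pack S H1.
pose H2 := isPrimeIdealrClosed.Build R S pS.
exists (HB.pack S H1 H2 : prime_idealr R).
by apply/seteqP; split=> x /=; [move=> /asboolP | move=> Px; apply/asboolP].
Qed.

Lemma idealr_of J : is_ideal J -> ~ J 1 -> exists j : idealr R, [set` j] = J.
Proof.
move=> iJ J1; pose S : {pred R} := fun x => `[< J x >].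
have cS : idealr_closed S.
  split=> [||a x y /asboolP Px /asboolP Py]; first by apply/asboolP; case: iJ.
    by apply/asboolP.
  by apply/asboolP; apply: iJ.2.
pose H1 := isIdealr.Build R S cS.
exists (HB.pack S H1 : idealr R).
by apply/seteqP; split=> x /=; [move=> /asboolP | move=> Px; apply/asboolP].
Qed.

Definition min_prime_over J P : Prop :=
  [/\ is_prime P, J `<=` P &
      forall Q, is_prime Q -> J `<=` Q -> Q `<=` P -> P `<=` Q].

(** A listed prime inside another one can be dropped.  If there is none and [y]
    avoids all primes but the first, which contains it, adding to [y] an element
    of [J] and of the other primes, but not of the first, does it. *)
Lemma prime_avoidance J (Ps : list (set R)) : is_ideal J ->
  (forall P, List.In P Ps -> is_prime P /\ ~ (J `<=` P)) ->
  exists2 y, J y & forall P, List.In P Ps -> ~ P y.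
Proof.
move=> iJ; have [n le_n] := ubnP (size Ps); elim: n Ps le_n => // n IH.
case=> [|P Qs] /= le_n HPs; first by exists 0 => //; case: iJ.
have [pP JP] := HPs P (or_introl erefl).
case: (pselect (exists2 Q, List.In Q Qs & Q `<=` P)) => [[Q QQs QP]|noQ].
  have [l1 [l2 def]] := List.in_split _ _ QQs.
  have [|P'|y Jy yP] := IH (P :: l1 ++ l2).
  - by move: le_n; rewrite def !size_cat /= size_cat /= addnS !ltnS.
  - move=> [<-|Pin]; first exact: HPs (or_introl erefl).
    apply: HPs; right; rewrite def; apply/List.in_or_app.
    by case: (List.in_app_or _ _ _ Pin) => ?; [left|right; right].
  exists y => // P' [<-|]; first by apply: yP; left.
  rewrite def => P'in.
  case: (List.in_app_or _ _ _ P'in) => [P'l|[<-|P'l]].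
  - by apply: yP; right; apply/List.in_or_app; left.
  - by move=> /QP; apply: yP; left.
  - by apply: yP; right; apply/List.in_or_app; right.
have [x [Jx nPx xQ]] : exists x, [/\ J x, ~ P x & forall Q, List.In Q Qs -> Q x].
  have [x0 [Jx0 nPx0]] : exists x, J x /\ ~ P x.
    by apply: contrapT => H; apply: JP => x Jx; apply: contrapT => nPx; apply: H; exists x.
  have {le_n IH} HQ : forall Q, List.In Q Qs -> is_prime Q /\ ~ (Q `<=` P).
    move=> Q QQs; split; first exact: (HPs Q (or_intror QQs)).1.
    by move=> QP; apply: noQ; exists Q.
  elim: Qs {HPs noQ} HQ => [|Q Qs IH] HQ; first by exists x0; split.
  have [|x [Jx nPx xQ]] := IH; first by move=> Q' ?; apply: HQ; right.
  have [pQ QP] := HQ Q (or_introl erefl).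
  have [z [Qz nPz]] : exists z, Q z /\ ~ P z.
    by apply: contrapT => H; apply: QP => z Qz; apply: contrapT => nPz; apply: H; exists z.
  exists (z * x); split; first exact: idealM.
    by case: pP => _ _ /[apply] -[].
  move=> Q' [<-|Q'in]; first by apply: is_idealMr => //; case: pQ.
  apply: idealM; first by have [[]] := HQ Q' (or_intror Q'in).
  exact: xQ.
have [|P' P'in|y Jy yQ] := IH Qs; first by rewrite -ltnS.
  by apply: HPs; right.
case: (pselect (P y)) => [Py|nPy]; last first.
  by exists y => // P' [<-//|]; apply: yQ.
exists (y + x); first exact: idealD.
move=> P' [<-|P'in].
  by case: pP => iP _ _ Pyx; apply: nPx; rewrite -(addKr y x); apply: idealD => //; apply: idealN.
have [[iP' _ _] _] := HPs P' (or_intror P'in).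
move=> Pyx; apply: (yQ P' P'in); rewrite -(addrK x y); apply: idealB => //.
exact: xQ.
Qed.

End Primes.

(** * Noetherian rings *)

Section Noetherian.
Variable R : comNzRingType.
Hypothesis noethR : noetherian R.
Implicit Types (J K L P Q T : set R).

Lemma noeth_chain (u : nat -> set R) : (forall i, is_ideal (u i)) ->
  (forall i, u i `<=` u i.+1) -> exists n, forall i, u i `<=` u n.
Proof.
move=> iu uS.
have u_le i j : (i <= j)%N -> u i `<=` u j.
  move=> /subnK <-; elim: (j - i)%N => // k IH x /IH; apply: uS.
pose U := [set x | exists i, u i x].
have iU : is_ideal U.
  apply: is_idealP; first by exists 0%N; case: (iu 0%N).
    move=> x y [i ux] [j uy]; exists (maxn i j); apply: idealD => //.
      by apply: u_le ux; apply: leq_maxl.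
    by apply: u_le uy; apply: leq_maxr.
  by move=> a x [i ux]; exists i; apply: idealM.
have [s Us] := noethR iU.
have [n sn] : exists n, forall x, x \in s -> u n x.
  have: forall x, x \in s -> U x by move=> x xs; rewrite Us; apply: sub_ideal_span.
  elim: s {Us} => [|x s IH] sU; first by exists 0%N.
  have [|n sn] := IH; first by move=> y ys; apply: sU; rewrite inE ys orbT.
  have [i ui] := sU x (mem_head _ _).
  exists (maxn i n) => y; rewrite inE => /orP[/eqP->|/sn].
    by apply: u_le ui; apply: leq_maxl.
  by apply: u_le; apply: leq_maxr.
exists n => i x ux; have : U x by exists i.
by rewrite Us; apply: ideal_span_min.
Qed.

(** A family without maximal member would contain a strictly increasing
    sequence, by dependent choice. *)
Lemma noeth_max (Phi : set R -> Prop) : (forall J, Phi J -> is_ideal J) ->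
  (exists J, Phi J) ->
  exists2 J, Phi J & forall K, Phi K -> J `<=` K -> K `<=` J.
Proof.
move=> PhiI [J0 PhiJ0]; apply: contrapT => noM.
have next (J : {J | Phi J}) : {K : {K | Phi K} | sval J `<=` sval K /\ ~ (sval K `<=` sval J)}.
  apply: cid; apply: contrapT => H; apply: noM; exists (sval J).
    exact: (svalP J).
  move=> K PhiK JK; apply: contrapT => KJ; apply: H.
  by exists (exist _ K PhiK).
pose v := fix v n := if n is n'.+1 then sval (next (v n')) else exist _ J0 PhiJ0.
have [n vn] := @noeth_chain (fun i => sval (v i)) (fun i => PhiI _ (svalP (v i)))
  (fun i => (svalP (next (v i))).1).
exact: (svalP (next (v n))).2 (vn n.+1).
Qed.

Lemma noeth_ind (Phi : set R -> Prop) :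
  (forall J, is_ideal J ->
     (forall K, is_ideal K -> J `<=` K -> ~ (K `<=` J) -> Phi K) -> Phi J) ->
  forall J, is_ideal J -> Phi J.
Proof.
move=> H J iJ; apply: contrapT => nJ.
have [_ [] //||K [iK nK] maxK] := @noeth_max (fun J => is_ideal J /\ ~ Phi J).
  by exists J.
apply: nK; apply: H => // L iL KL LK; apply: contrapT => nL; apply: LK.
exact: maxK.
Qed.

(** An ideal maximal among those that contain [J] and miss [W] is prime. *)
Lemma prime_missing J (W : set R) : is_ideal J -> W 1 ->
  (forall a b, W a -> W b -> W (a * b)) -> (forall a, J a -> ~ W a) ->
  exists P, [/\ is_prime P, J `<=` P & forall a, P a -> ~ W a].
Proof.
move=> iJ W1 WM JW.
have [||P [iP JP PW] maxP] := @noeth_max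
    (fun K => [/\ is_ideal K, J `<=` K & forall a, K a -> ~ W a]).
- by move=> K [].
- by exists J; split.
exists P; split => //; split => [//|/PW/(_ W1)//|a b Pab].
apply: contrapT => /not_orP[nPa nPb].
have ext x : ~ P x -> exists p r, P p /\ W (p + r * x).
  move=> nPx; apply: contrapT => H; apply: nPx.
  pose K := ideal_add P [set r * x | r in setT].
  have ix := principal_ideal x.
  have iK : is_ideal K by apply: ideal_add_ideal.
  apply: (maxP K); last by apply: ideal_addr => //; exists 1 => //; rewrite mul1r.
    split => //; first by move=> y /JP Py; apply: ideal_addl.
    by move=> _ [p Pp [_ [r _ <-] <-]] Wp; apply: H; exists p, r.
  exact: ideal_addl.
have [p [r [Pp Wp]]] := ext a nPa; have [q [t [Pq Wq]]] := ext b nPb.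
apply: (PW _ _ (WM _ _ Wp Wq)).
rewrite (_ : _ * _ = (q + t * b) * p + (r * a) * q + (r * t) * (a * b)); last by ring.
by do ![apply: idealD => //]; apply: idealM.
Qed.

(** By Noetherian induction: when [a * b] is in [J], a prime over [J] lies over
    [J + (a)] or over [J + (b)]. *)
Lemma primes_over_fin J : is_ideal J ->
  exists Ps : list (set R),
    (forall P, List.In P Ps -> is_prime P /\ J `<=` P) /\
    (forall Q, is_prime Q -> J `<=` Q -> exists2 P, List.In P Ps & P `<=` Q).
Proof.
move: J; apply: noeth_ind => J iJ IH.
case: (pselect (J 1)) => [J1|nJ1].
  by exists nil; split => // Q [_ Q1 _] /(_ _ J1).
case: (pselect (is_prime J)) => [pJ|npJ].
  exists [:: J]; split; first by move=> P [<-|//]; split => // x.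
  by move=> Q _ JQ; exists J => //; left.
have [a [b [Jab nJa nJb]]] : exists a b, [/\ J (a * b), ~ J a & ~ J b].
  apply: contrapT => H; apply: npJ; split => // a b Jab.
  by apply: contrapT => /not_orP[nJa nJb]; apply: H; exists a, b.
have sub x : ~ J x -> exists Ps : list (set R),
    (forall P, List.In P Ps -> is_prime P /\ J `<=` P) /\
    (forall Q, is_prime Q -> J `<=` Q -> Q x -> exists2 P, List.In P Ps & P `<=` Q).
  move=> nJx; pose K := ideal_span (J `|` [set x]).
  have JK : J `<=` K by move=> y Jy; apply: sub_ideal_span; left.
  have [|Ps [H1 H2]] := IH K (ideal_span_ideal _) JK.
    by move=> /(_ x) H; apply: nJx; apply: H; apply: sub_ideal_span; right.
  exists Ps; split; first by move=> P /H1[pP KP]; split => // y /JK/KP.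
  move=> Q pQ JQ Qx; apply: H2 => //; apply: ideal_span_min; first by case: pQ.
  by move=> y [/JQ //|->].
have [Ps [HP1 HP2]] := sub a nJa; have [Qs [HQ1 HQ2]] := sub b nJb.
exists (Ps ++ Qs); split.
  by move=> P Pin; case: (List.in_app_or _ _ _ Pin) => [/HP1|/HQ1].
move=> Q pQ JQ; case: (pQ) => _ _ /(_ a b (JQ _ Jab)) [Qa|Qb].
  have [P Pin PQ] := HP2 Q pQ JQ Qa; exists P => //.
  by apply/List.in_or_app; left.
have [P Pin PQ] := HQ2 Q pQ JQ Qb; exists P => //.
by apply/List.in_or_app; right.
Qed.

Lemma min_prime_below J T : is_ideal J -> is_prime T -> J `<=` T ->
  exists2 P, min_prime_over J P & P `<=` T.
Proof.
move=> iJ pT JT; have [Ps [H1 H2]] := primes_over_fin iJ.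
have minl : forall (l : list (set R)) Q, List.In Q l -> exists P,
    [/\ List.In P l, P `<=` Q & forall P', List.In P' l -> P' `<=` P -> P `<=` P'].
  elim=> // P0 l IH Q Qin.
  have [P1 [P1in P1Q minP1]] : exists P1, [/\ List.In P1 (P0 :: l), P1 `<=` Q &
      forall P', List.In P' l -> P' `<=` P1 -> P1 `<=` P'].
    case: (pselect (exists2 P', List.In P' l & P' `<=` Q)) => [[P' P'in P'Q]|no].
      have [P [Pin PP' minP]] := IH P' P'in.
      by exists P; split => //; [by right | move=> x /PP' /P'Q].
    exists Q; split => [//|x //|P' P'in P'Q]; by case: no; exists P'.
  case: (pselect (P0 `<=` P1)) => [P01|nP01]; last first.
    by exists P1; split => // P' [<-|/minP1 //].
  exists P0; split; [by left | by move=> x /P01/P1Q |].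
  move=> P' [<- //|P'in] P'0; move=> x /P01; apply: minP1 => //.
  by move=> y /P'0/P01.
have [P0 P0in P0T] := H2 T pT JT.
have [P [Pin PP0 minP]] := minl Ps P0 P0in.
have [pP JP] := H1 P Pin.
exists P; last by move=> x /PP0/P0T.
split => // Q pQ JQ QP; have [P' P'in P'Q] := H2 Q pQ JQ.
have PP' : P `<=` P' by apply: minP => // y /P'Q/QP.
by move=> x /PP'/P'Q.
Qed.

(** Otherwise the multiplicative set of the [s * a ^+ k] would miss [J], and a
    prime missing it would be a smaller prime over [J]. *)
Lemma min_prime_nilp J T a : is_ideal J -> min_prime_over J T -> T a ->
  exists s k, ~ T s /\ J (s * a ^+ k).
Proof.
move=> iJ [pT JT minT] Ta; apply: contrapT => no.
have [iT T1 TM] := pT.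
have [|||P [pP JP PW]] := @prime_missing J [set x | exists s k, ~ T s /\ x = s * a ^+ k] iJ.
- by exists 1, 0%N; split => //; rewrite mul1r.
- move=> _ _ [s [k [Ts ->]]] [s' [k' [Ts' ->]]]; exists (s * s'), (k + k')%N.
  by split; [move=> /TM[] | rewrite exprD mulrACA].
- by move=> x Jx [s [k [Ts defx]]]; apply: no; exists s, k; rewrite -defx.
have PT : P `<=` T.
  move=> x Px; apply: contrapT => Tx; apply: (PW x Px).
  by exists x, 0%N; rewrite mulr1.
have Pa : P a by apply: minT.
by apply: (PW a Pa); exists 1, 1%N; rewrite mul1r.
Qed.

End Noetherian.

(** * Local rings *)

Section LocalRings.
Variable R : comNzRingType.
Implicit Types (J K L P Q T : set R).

Definition is_local (n : set R) : Prop :=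
  [/\ is_ideal n, ~ n 1 & forall a, ~ n a -> exists b, a * b = 1].

Lemma local_prime n : is_local n -> is_prime n.
Proof.
move=> [iN N1 Nu]; split => // a b Nab; apply: contrapT => /not_orP[na nb].
have [a' aa'] := Nu a na; have [b' bb'] := Nu b nb; apply: N1.
rewrite (_ : 1 = (a' * b') * (a * b)); first exact: idealM.
by rewrite mulrACA [a' * a]mulrC [b' * b]mulrC aa' bb' mulr1.
Qed.

Lemma local_sub n J : is_local n -> is_ideal J -> ~ J 1 -> J `<=` n.
Proof.
move=> [_ _ Nu] iJ J1 x Jx; apply: contrapT => /Nu[b xb]; apply: J1.
by rewrite -xb; apply: is_idealMr.
Qed.

(** Nakayama's lemma: the first generator is expressed through the others by
    dividing by some [1 - a] with [a] in [n], a unit. *)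
Lemma nakayama n J (s : seq R) : is_local n -> is_ideal J ->
  (forall g, g \in s -> ideal_add J (ideal_mul n (ideal_span [set` s])) g) ->
  forall g, g \in s -> J g.
Proof.
move=> locn iJ; have [iN N1 Nu] := locn.
elim: s => // g s IH Hs.
have split_gs x : ideal_mul n (ideal_span [set` g :: s]) x ->
    exists a y, [/\ n a, ideal_mul n (ideal_span [set` s]) y & x = a * g + y].
  have iM := ideal_mul_ideal n (ideal_span [set` s]).
  move: x; apply: ideal_mul_min => [|a w na].
    apply: is_idealP.
    - by exists 0, 0; split; [case: iN|case: iM|rewrite mul0r addr0].
    - move=> _ _ [a [y [na ny ->]]] [a' [y' [na' ny' ->]]].
      exists (a + a'), (y + y'); split; [exact: idealD|exact: (idealD iM)|].
      by rewrite mulrDl addrACA.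
    - move=> c _ [a [y [na ny ->]]]; exists (c * a), (c * y).
      by split; [exact: idealM|exact: (idealM _ iM)|rewrite mulrDr mulrA].
  pose L := [set y | exists c z, ideal_span [set` s] z /\ y = c * g + z].
  suff sL : ideal_span [set` g :: s] `<=` L.
    move=> /sL[c [z [sz ->]]]; exists (a * c), (a * z).
    by split; [exact: is_idealMr|exact: ideal_mulM|rewrite mulrDr mulrA].
  have iS := @ideal_span_ideal R [set` s].
  apply: ideal_span_min => [|y /=].
    apply: is_idealP.
    - by exists 0, 0; split; [case: iS|rewrite mul0r addr0].
    - move=> _ _ [c [z [sz ->]]] [c' [z' [sz' ->]]].
      exists (c + c'), (z + z'); split; first exact: (idealD iS).
      by rewrite mulrDl addrACA.
    - move=> d _ [c [z [sz ->]]]; exists (d * c), (d * z).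
      by split; [exact: (idealM _ iS)|rewrite mulrDr mulrA].
  rewrite inE => /orP[/eqP->|ys].
    by exists 1, 0; split; [case: iS|rewrite mul1r addr0].
  by exists 0, y; split; [exact: sub_ideal_span|rewrite mul0r add0r].
set K := ideal_add J (ideal_mul n (ideal_span [set` s])).
have iK : is_ideal K by apply: ideal_add_ideal => //; apply: ideal_mul_ideal.
have Kg : K g.
  have [x Jx [_ /split_gs[a [y [na ny ->]]] defg]] := Hs g (mem_head _ _).
  have [|u ua] := Nu (1 - a).
    move=> n1a; apply: N1; rewrite -(subrK a 1); exact: idealD.
  have -> : g = u * (x + y).
    have -> : x + y = (1 - a) * g by rewrite mulrBl mul1r -{1}defg; ring.
    by rewrite mulrA [u * _]mulrC ua mul1r.
  by apply: idealM => //; exists x => //; exists y.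
have Js h : h \in s -> J h.
  apply: IH => {}h hs.
  have [|x Jx [_ /split_gs[a [y [na ny ->]]] <-]] := Hs h.
    by rewrite inE hs orbT.
  apply: idealD => //; first exact: ideal_addl (ideal_mul_ideal _ _) _ Jx.
  by apply: idealD => //; [apply: idealM | apply: ideal_addr].
move=> h; rewrite inE => /orP[/eqP->|]; last exact: Js.
move: (g) Kg; apply: ideal_add_min => //; apply: ideal_mul_min => // a y _ sy.
by apply: idealM => //; move: y sy; apply: ideal_span_min.
Qed.

Lemma nakayama_sub n J K : noetherian R -> is_local n -> is_ideal J ->
  is_ideal K -> K `<=` ideal_add J (ideal_mul n K) -> K `<=` J.
Proof.
move=> noeth locn iJ iK; have [s ->] := noeth K iK => sub.
apply: ideal_span_min => // g gs; apply: (nakayama locn iJ) gs => h hs.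
by apply: sub; apply: sub_ideal_span.
Qed.

End LocalRings.

(** * Ideals along ring morphisms *)

Section Morphisms.
Variables (R S : comNzRingType) (f : {rmorphism R -> S}).

Lemma preimage_ideal (J : set S) : is_ideal J -> is_ideal (f @^-1` J).
Proof.
move=> iJ; split=> [|a x y] /=; first by rewrite rmorph0; case: iJ.
by rewrite rmorphD rmorphM; apply: iJ.2.
Qed.

Lemma preimage_prime (P : set S) : is_prime P -> is_prime (f @^-1` P).
Proof.
move=> [iP P1 PM]; split; [exact: preimage_ideal|by rewrite /= rmorph1|].
by move=> a b; rewrite /= rmorphM; apply: PM.
Qed.

Lemma ideal_ext_ideal (J : set R) : is_ideal (ideal_ext f J).
Proof. exact: ideal_span_ideal. Qed.

Lemma ideal_ext_mem (J : set R) x : J x -> ideal_ext f J (f x).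
Proof. by move=> Jx; apply: sub_ideal_span; exists x. Qed.

Lemma ideal_ext_min (J : set R) (K : set S) : is_ideal K ->
  (forall x, J x -> K (f x)) -> ideal_ext f J `<=` K.
Proof. by move=> iK JK; apply: ideal_span_min => // _ [x /JK Kx <-]. Qed.

Lemma ideal_ext_sub (J K : set R) : J `<=` K -> ideal_ext f J `<=` ideal_ext f K.
Proof.
by move=> JK; apply: ideal_ext_min (ideal_ext_ideal _) _ => x /JK; apply: ideal_ext_mem.
Qed.

Lemma ideal_ext_exp (J : set R) k x :
  ideal_exp J k x -> ideal_exp (ideal_ext f J) k (f x).
Proof.
elim: k x => // k IH x.
suff: ideal_exp J k.+1 `<=` f @^-1` (ideal_exp (ideal_ext f J) k.+1) by apply.
apply: ideal_mul_min; first by apply: preimage_ideal; apply: ideal_exp_ideal.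
move=> a b Ja /IH fb; rewrite /= rmorphM; apply: ideal_mulM => //.
exact: ideal_ext_mem.
Qed.

Lemma ideal_exp_ext (J : set R) k (y : S) :
  ideal_exp (ideal_ext f J) k y -> ideal_ext f (ideal_exp J k) y.
Proof.
elim: k y => [|k IH] y.
  by move=> _; rewrite -[y]mulr1 -(rmorph1 f); apply: (idealM _ (ideal_ext_ideal _));
    apply: ideal_ext_mem.
move: y; suff: ideal_exp (ideal_ext f J) k.+1 `<=` ideal_ext f (ideal_exp J k.+1) by [].
have iE := ideal_ext_ideal (ideal_exp J k.+1).
apply: ideal_mul_min => // x y Jx /IH Jy.
move: x Jx; suff: ideal_ext f J `<=` [set x | ideal_ext f (ideal_exp J k.+1) (x * y)] by [].
apply: ideal_ext_min => [|a Ja].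
  split=> /=; first by rewrite mul0r; case: iE.
  by move=> r u v Hu Hv; rewrite mulrDl -mulrA; apply: iE.2.
move: y Jy; suff: ideal_ext f (ideal_exp J k) `<=`
    [set y | ideal_ext f (ideal_exp J k.+1) (f a * y)] by [].
apply: ideal_ext_min => [|b Jb].
  split=> /=; first by rewrite mulr0; case: iE.
  by move=> r u v Hu Hv; rewrite mulrDr mulrCA; apply: iE.2.
by rewrite /= -rmorphM; apply: ideal_ext_mem; apply: ideal_mulM.
Qed.

End Morphisms.

Section SurjectivePrimes.
Variables (R S : comNzRingType) (f : {rmorphism R -> S}).
Hypothesis f_surj : forall y, exists x, f x = y.

Lemma image_ideal (J : set R) : is_ideal J -> is_ideal (f @` J).
Proof.
move=> iJ; split; first by exists 0; [case: iJ|rewrite rmorph0].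
move=> a _ _ [x Jx <-] [y Jy <-]; have [b <-] := f_surj a.
by exists (b * x + y); [apply: iJ.2|rewrite rmorphD rmorphM].
Qed.

Lemma preimage_image_ideal (J : set R) : is_ideal J -> (forall x, f x = 0 -> J x) ->
  f @^-1` (f @` J) = J.
Proof.
move=> iJ kerJ; apply/seteqP; split=> x; last by move=> Jx; exists x.
move=> [y Jy fxy]; apply: (idealBr iJ _ Jy); apply: kerJ.
by rewrite rmorphB fxy subrr.
Qed.

Lemma image_prime (P : set R) : is_prime P -> (forall x, f x = 0 -> P x) ->
  is_prime (f @` P).
Proof.
move=> [iP P1 PM] kerP; have pre := preimage_image_ideal iP kerP.
have fP x : (f @` P) (f x) -> P x by move=> H; rewrite -pre.
split; first exact: image_ideal.
  by rewrite -(rmorph1 f) => /fP.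
move=> a b; have [x <-] := f_surj a; have [y <-] := f_surj b.
by rewrite -rmorphM => /fP/PM[Px|Py]; [left; exists x|right; exists y].
Qed.

End SurjectivePrimes.

Section Radical.
Variable R : comNzRingType.
Implicit Types (J K : set R).

Lemma radical_ideal J : is_ideal J -> is_ideal (radical J).
Proof.
move=> iJ; apply: is_idealP; first by exists 1%N; case: iJ.
  move=> x y [k Jx] [l Jy]; exists (k + l)%N; rewrite exprDn.
  apply: ideal_sum => // -[i /= lei] _; rewrite -mulr_natl; apply: idealM => //.
  case: (leqP k (k + l - i)%N) => [le|lt].
    by rewrite -(subnK le) exprD -mulrA mulrC; apply: is_idealMr => //; apply: is_idealMr.
  have le : (l <= i)%N by lia.
  by rewrite -(subnK le) exprD mulrA; apply: idealM.
by move=> a x [k Jx]; exists k; rewrite exprMn; apply: idealM.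
Qed.

Lemma radical_sub J K : J `<=` K -> radical J `<=` radical K.
Proof. by move=> JK x [k /JK Kx]; exists k. Qed.

Lemma prime_radical (P : set R) : is_prime P -> radical P `<=` P.
Proof. by move=> pP x [k]; apply: primeX. Qed.

End Radical.

(** * Hilbert's basis theorem *)

Section HilbertBasis.
Variable R : comNzRingType.
Hypothesis noethR : noetherian R.

(** Subtracting a member of a finitely generated part of the ideal with the same
    leading term lowers the degree; finitely many generators provide the leading
    coefficients of all degrees because the ideals of leading coefficients in
    degree [n] increase with [n]. *)
Lemma noetherian_poly : noetherian {poly R}.
Proof.
move=> J iJ.
pose lead_ideal (G : set {poly R}) n :=
  [set a | exists f : {poly R}, [/\ G f, (size f <= n.+1)%N & f`_n = a]].
have leadP G n : is_ideal G -> is_ideal (lead_ideal G n).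
  move=> iG; apply: is_idealP.
  - by exists 0; rewrite size_poly0 coef0; split => //; case: iG.
  - move=> _ _ [f [Gf sf <-]] [g [Gg sg <-]]; exists (f + g).
    split; [exact: idealD | | by rewrite coefD].
    by rewrite (leq_trans (size_polyD _ _)) // geq_max sf.
  - move=> a _ [f [Gf sf <-]]; exists (a *: f).
    split; [by rewrite -mul_polyC; apply: idealM | | by rewrite coefZ].
    exact: leq_trans (size_scale_leq _ _) sf.
have leadS G n : is_ideal G -> lead_ideal G n `<=` lead_ideal G n.+1.
  move=> iG _ [f [Gf sf <-]]; exists (f * 'X).
  split; [exact: is_idealMr | | by rewrite coefMX].
  by rewrite (leq_trans (size_polyMleq _ _)) // size_polyX addn2.
have [N HN] := noeth_chain noethR (fun n => leadP J n iJ) (fun n => leadS J n iJ).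
have gens n : {s : seq {poly R} | (forall f, f \in s -> J f) /\
    lead_ideal J n `<=` lead_ideal (ideal_span [set` s]) n}.
  apply: cid; have [t Et] := noethR (leadP J n iJ).
  have [F HF] : {F : R -> {poly R} & forall a, a \in t ->
      [/\ J (F a), (size (F a) <= n.+1)%N & (F a)`_n = a]}.
    apply: (@choice _ _ (fun a f => a \in t -> [/\ J f, (size f <= n.+1)%N & f`_n = a])).
    move=> a; case: (pselect (lead_ideal J n a)) => [[f Hf]|nLa]; first by exists f.
    by exists 0 => at_; case: nLa; rewrite Et; apply: sub_ideal_span.
  exists [seq F a | a <- t]; split; first by move=> _ /mapP[a /HF[Ja _ _] ->].
  rewrite Et; apply: ideal_span_min; first by apply: leadP; apply: ideal_span_ideal.
  move=> a /= at_; have [_ sF Fa] := HF a at_; exists (F a); split => //.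
  by apply: sub_ideal_span; apply: map_f.
pose G := flatten [seq sval (gens n) | n <- iota 0 N.+1]; exists G.
have iG := @ideal_span_ideal _ [set` G].
have GJ : ideal_span [set` G] `<=` J.
  apply: ideal_span_min => // f /= /flatten_mapP[n _ fn].
  exact: (svalP (gens n)).1.
have leadG n : lead_ideal J n `<=` lead_ideal (ideal_span [set` G]) n.
  have small k : (k <= N)%N -> lead_ideal J k `<=` lead_ideal (ideal_span [set` G]) k.
    move=> lekN a /(svalP (gens k)).2[f [Gf sf fa]]; exists f; split => //.
    move: (f) Gf; apply: ideal_span_sub => g /= gk; apply/flatten_mapP.
    by exists k => //; rewrite mem_iota.
  case: (leqP n N) => [/small //|/ltnW ltNn] a /HN /small -/(_ (leqnn N)).
  rewrite -(subnK ltNn); elim: (n - N)%N => // k IH /IH.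
  exact: leadS.
apply/seteqP; split => // f; have [n] := ubnP (size f).
elim: n f => // n IH f ltfn Jf.
have [->|nzf] := eqVneq f 0; first by case: iG.
have szf : size f = (size f).-1.+1 by rewrite prednK // size_poly_gt0.
have [|g [Gg sg Eg]] := leadG (size f).-1 (f`_(size f).-1).
  by exists f; split => //; rewrite -szf.
rewrite -(subrK g f); apply: (idealD iG) => //; apply: IH; last first.
  by apply: idealB => //; apply: GJ.
rewrite ltnS in ltfn; apply: leq_trans ltfn; rewrite szf ltnS.
apply/leq_sizeP => j; rewrite leq_eqVlt => /orP[/eqP<-|ltj].
  by rewrite coefB Eg subrr.
by rewrite coefB !nth_default ?subrr // ?(leq_trans sg) // szf.
Qed.

End HilbertBasis.

(** * The Rees algebra *)

Section Rees.
Variable R : comNzRingType.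
Hypothesis noethR : noetherian R.
Implicit Types (J K : set R).

(** One polynomial variable is added for each member [x] of [s] and sent to
    [x *: 'X]; Hilbert's basis theorem keeps the ring Noetherian. *)
Lemma rees_gens J (s : seq R) : is_ideal J -> (forall x, x \in s -> J x) ->
  exists (P : comNzRingType) (rho : {rmorphism R -> P})
         (ev : {rmorphism P -> {poly R}}),
    [/\ noetherian P, forall r, ev (rho r) = r%:P,
        forall f n, ideal_exp J n (ev f)`_n &
        forall x, x \in s -> exists f, ev f = x *: 'X].
Proof.
move=> iJ; elim: s => [|x s IH] sJ.
  exists R, idfun, polyC; split => // f [|n]; first by rewrite coefC.
  by rewrite coefC; apply: (ideal0 (@ideal_exp_ideal R J n.+1)).
have [|P [rho [ev [noethP evrho evJ evs]]]] := IH.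
  by move=> y ys; apply: sJ; rewrite inE ys orbT.
pose u := x *: 'X : {poly R}.
have cu : commr_rmorph ev u by move=> a; apply: mulrC.
exists {poly P}, (polyC \o rho), (horner_morph cu); split.
- exact: noetherian_poly.
- by move=> r; rewrite /= horner_morphC evrho.
- move=> f; elim/poly_ind: f => [|f c IHf] n.
    by rewrite rmorph0 coef0; apply: (ideal0 (@ideal_exp_ideal R J n)).
  have iJn := @ideal_exp_ideal R J n.
  rewrite rmorphD rmorphM /= horner_morphX horner_morphC coefD.
  apply: (idealD iJn) => //; rewrite /u -scalerAr coefZ coefMX.
  case: n iJn => [|n] iJn; first by rewrite mulr0; case: iJn.
  by apply: ideal_mulM; [apply: sJ; rewrite mem_head | apply: IHf].
- move=> y; rewrite inE => /orP[/eqP->|/evs[f evf]].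
    by exists 'X; rewrite /= horner_morphX.
  by exists f%:P; rewrite /= horner_morphC.
Qed.

(** The image of [ev] is the Rees algebra of [J], the ring of the polynomials
    whose coefficient of ['X^n] is in [J ^ n]. *)
Lemma rees J : is_ideal J ->
  exists (P : comNzRingType) (rho : {rmorphism R -> P})
         (ev : {rmorphism P -> {poly R}}),
    [/\ noetherian P, forall r, ev (rho r) = r%:P,
        forall f n, ideal_exp J n (ev f)`_n &
        forall n x, ideal_exp J n x -> exists f, ev f = x *: 'X^n].
Proof.
move=> iJ; have [s Es] := noethR iJ.
have [|P [rho [ev [noethP evrho evJ evs]]]] := @rees_gens J s iJ.
  by move=> x xs; rewrite Es; apply: sub_ideal_span.
exists P, rho, ev; split => //.
have ev_ideal n : is_ideal [set x | exists f, ev f = x *: 'X^n].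
  split; first by exists 0; rewrite rmorph0 scale0r.
  move=> a x y [f Ef] [g Eg]; exists (rho a * f + g).
  by rewrite rmorphD rmorphM /= evrho Ef Eg mul_polyC scalerDl scalerA.
have evJ1 x : J x -> exists f, ev f = x *: 'X^1.
  by rewrite Es; apply: (ideal_span_min (ev_ideal 1%N)) => y /= /evs.
elim=> [|n IH] x.
  by move=> _; exists (rho x); rewrite evrho -alg_polyC expr0.
move: x; refine (ideal_mul_min (ev_ideal n.+1) _) => a b /evJ1[f Ef] /IH[g Eg].
by exists (f * g); rewrite rmorphM /= Ef Eg expr1 -scalerAl -scalerAr scalerA exprS.
Qed.

Lemma ideal_expD_sub J i j :
  ideal_exp J (i + j) `<=` ideal_mul (ideal_exp J i) (ideal_exp J j).
Proof.
elim: i => [|i IH] x; first by rewrite -{2}[x]mul1r => Jx; apply: ideal_mulM.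
move: x; apply: ideal_mul_min; first exact: ideal_mul_ideal.
move=> a b Ja /IH; move: b.
pose L := [set b | ideal_mul (ideal_exp J i.+1) (ideal_exp J j) (a * b)].
have iM := ideal_mul_ideal (ideal_exp J i.+1) (ideal_exp J j).
suff: ideal_mul (ideal_exp J i) (ideal_exp J j) `<=` L by [].
apply: ideal_mul_min => [|b c Jb Jc].
  split; rewrite /L /=; first by rewrite mulr0; case: iM.
  by move=> r u v Lu Lv; rewrite mulrDr mulrCA; apply: iM.2.
by rewrite /L /= mulrA; apply: ideal_mulM => //; apply: ideal_mulM.
Qed.

(** The family [K] is a graded ideal of the Rees algebra, so it comes from an
    ideal of a Noetherian ring; [d] bounds the degrees of finitely many
    generators of that ideal. *)
Lemma graded_stable J (K : nat -> set R) : is_ideal J ->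
  (forall n, is_ideal (K n)) -> (forall n, K n `<=` ideal_exp J n) ->
  (forall n x y, J x -> K n y -> K n.+1 (x * y)) ->
  exists d, forall i, K (d + i)%N `<=` ideal_mul (ideal_exp J i) (K d).
Proof.
move=> iJ iK KJ JK.
have JKn i n x y : ideal_exp J i x -> K n y -> K (i + n)%N (x * y).
  elim: i x => [|i IH] x; first by move=> _ Ky; apply: idealM.
  move=> Jx Ky; move: x Jx.
  suff: ideal_exp J i.+1 `<=` [set x | K (i.+1 + n)%N (x * y)] by [].
  apply: ideal_mul_min => [|a b Ja Jb].
    split=> /=; first by rewrite mul0r; case: (iK (i.+1 + n)%N).
    by move=> a u v Ku Kv; rewrite mulrDl -mulrA; apply: (iK _).2.
  by rewrite /= -mulrA addSn; apply: JK => //; apply: IH.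
have [P [rho [ev [noethP evrho evJ evs]]]] := rees iJ.
pose KK := [set f : P | forall n, K n (ev f)`_n].
have iKK : is_ideal KK.
  split; first by move=> n; rewrite rmorph0 coef0; case: (iK n).
  move=> a f g Kf Kg n; rewrite rmorphD rmorphM /= coefD.
  apply: idealD => //; rewrite coefM; apply: ideal_sum => // -[i /= lei] _.
  by rewrite -{1}(subnKC (lei : (i <= n)%N)); apply: JKn.
have [t Et] := noethP _ iKK.
have Kt f : f \in t -> KK f by move=> ft; rewrite Et; apply: sub_ideal_span.
pose d := \max_(f <- t) size (ev f).
have tri i e l x y : ideal_exp J (i + e) x -> K l y ->
    ideal_mul (ideal_exp J i) (K (e + l)%N) (x * y).
  move=> /ideal_expD_sub + Ky; move: x.
  have iM := ideal_mul_ideal (ideal_exp J i) (K (e + l)%N).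
  suff: ideal_mul (ideal_exp J i) (ideal_exp J e) `<=`
        [set x | ideal_mul (ideal_exp J i) (K (e + l)%N) (x * y)] by [].
  apply: ideal_mul_min => [|a b Ja Jb].
    split=> /=; first by rewrite mul0r; case: iM.
    by move=> a u v Ku Kv; rewrite mulrDl -mulrA; apply: iM.2.
  by rewrite /= -mulrA; apply: ideal_mulM => //; apply: JKn.
exists d => i x Kx; have [f evf] := evs _ _ (KJ _ _ Kx).
have : KK f.
  move=> n; rewrite evf coefZ coefXn; case: eqP => [->|_]; first by rewrite mulr1.
  by rewrite mulr0; case: (iK n).
rewrite Et => /ideal_span_seqP[c Ef].
have -> : x = (ev f)`_(d + i) by rewrite evf coefZ coefXn eqxx mulr1.
rewrite Ef rmorph_sum coef_sum.
have iM := ideal_mul_ideal (ideal_exp J i) (K d).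
apply: ideal_sum => // -[k ltk] _ /=; set g := t`_k.
have gt : g \in t by apply: mem_nth.
rewrite rmorphM coefM; apply: ideal_sum => // -[j /= lej] _.
case: (leqP (size (ev g)) (d + i - j)) => [le|lt].
  by rewrite (nth_default _ le) mulr0; case: iM.
have led : (d + i - j <= d)%N.
  by apply: leq_trans (ltnW lt) _; apply: (@leq_bigmax_seq _ _ xpredT (fun f => size (ev f))).
have := @tri i (d - (d + i - j))%N (d + i - j)%N (ev (c k))`_j (ev g)`_(d + i - j).
rewrite (subnK led); apply; last exact: Kt.
by suff -> : (i + (d - (d + i - j)) = j)%N by []; lia.
Qed.
End Rees.

(** * The Artin-Rees lemma and Krull's intersection theorem *)

Section ArtinRees.
Variable R : comNzRingType.
Hypothesis noethR : noetherian R.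
Implicit Types (J K : set R).

Lemma artin_rees J K : is_ideal J -> is_ideal K ->
  exists d, forall i, ideal_exp J (d + i) `&` K `<=` ideal_mul (ideal_exp J i) K.
Proof.
move=> iJ iK.
have [|||d Hd] := @graded_stable R noethR J (fun n => ideal_exp J n `&` K) iJ.
- move=> n; have iJn := @ideal_exp_ideal R J n; split; first by split; [case: iJn|case: iK].
  by move=> a x y [Jx Kx] [Jy Ky]; split; [apply: iJn.2|apply: iK.2].
- by move=> n x [].
- by move=> n x y Jx [Jy Ky]; split; [apply: ideal_mulM|apply: idealM].
exists d => i x /Hd; apply: ideal_mul_sub => // y [] //.
Qed.

(** Krull's intersection theorem: with [D] the intersection, Artin-Rees gives
    [D <= J + n * D], and Nakayama's lemma applies. *)
Lemma krull_intersection n J x : is_local n -> is_ideal J ->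
  (forall k, ideal_add J (ideal_exp n k) x) -> J x.
Proof.
move=> locn iJ; have [iN _ _] := locn; move: x.
pose D := [set x | forall k, ideal_add J (ideal_exp n k) x].
have iA k : is_ideal (ideal_add J (ideal_exp n k)).
  by apply: ideal_add_ideal => //; apply: ideal_exp_ideal.
have iD : is_ideal D.
  split=> [k|a x y Dx Dy k]; first by case: (iA k).
  by apply: (iA k).2; [apply: Dx|apply: Dy].
have JD : J `<=` D.
  by move=> x Jx k; apply: ideal_addl => //; apply: ideal_exp_ideal.
suff: D `<=` J by [].
apply: (nakayama_sub noethR locn) => // x Dx.
have [d Hd] := artin_rees iN iD.
have [a Ja [b nb defx]] := Dx (d + 1)%N.
exists a => //; exists b => //; rewrite -(ideal_exp1 iN); apply: Hd; split => //.
by rewrite (_ : b = x - a); [apply: (idealB iD) => //; apply: JD | rewrite -defx addrC addKr].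
Qed.

End ArtinRees.

(** * Elements regular modulo all powers of an ideal, up to torsion *)

Section TorsionAvoidance.
Variables (R P : comNzRingType) (rho : {rmorphism R -> P}).
Hypothesis noethP : noetherian P.

(** Every ideal of a Noetherian ring is a finite intersection of irreducible
    ones; modulo an irreducible ideal each element is regular or nilpotent, and
    the nilpotent ones form a prime ideal.  It is enough to avoid the primes so
    obtained that do not contain [M]: the other components absorb powers of
    the members of [M]. *)
Lemma torsion_primes (M : set R) (K : set P) : is_ideal M -> is_ideal K ->
  exists Qs : list (set R),
    (forall Q, List.In Q Qs -> is_prime Q /\ ~ (M `<=` Q)) /\
    (forall y, (forall Q, List.In Q Qs -> ~ Q y) ->
       forall f, K (rho y * f) -> forall s, M s -> exists N, K (rho s ^+ N * f)).
Proof.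
move=> iM; move: K; apply: (noeth_ind noethP) => K iK IH.
pose reducible := exists K1 K2 : set P, [/\ is_ideal K1, is_ideal K2,
  K `<=` K1 /\ ~ (K1 `<=` K), K `<=` K2 /\ ~ (K2 `<=` K) &
  forall f, K1 f -> K2 f -> K f].
case: (pselect reducible) => [[K1 [K2 [iK1 iK2 [KK1 K1K] [KK2 K2K] K12]]]|irr].
  have [Qs1 [HQ1 H1]] := IH K1 iK1 KK1 K1K.
  have [Qs2 [HQ2 H2]] := IH K2 iK2 KK2 K2K.
  exists (Qs1 ++ Qs2); split.
    by move=> Q Qin; case: (List.in_app_or _ _ _ Qin) => [/HQ1|/HQ2].
  move=> y Hy f Kyf s Ms.
  have [||N1 KN1] := H1 y _ f _ s Ms; [|exact: KK1|].
    by move=> Q Qin; apply: Hy; apply/List.in_or_app; left.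
  have [||N2 KN2] := H2 y _ f _ s Ms; [|exact: KK2|].
    by move=> Q Qin; apply: Hy; apply/List.in_or_app; right.
  exists (N1 + N2)%N; apply: K12; rewrite exprD.
    by rewrite -mulrA mulrCA; apply: idealM.
  by rewrite -mulrA; apply: idealM.
pose nilp := rho @^-1` (radical K).
have inilp : is_ideal nilp by apply: preimage_ideal; apply: radical_ideal.
have regular y f : ~ nilp y -> K (rho y * f) -> K f.
  move=> ny Kyf.
  pose u i := [set g : P | K (rho y ^+ i * g)].
  have iu i : is_ideal (u i).
    split; rewrite /u /=; first by rewrite mulr0; case: iK.
    by move=> a g h Kg Kh; rewrite mulrDr mulrCA; apply: iK.2.
  have [|N HN] := noeth_chain noethP iu.
    by move=> i g; rewrite /u /= exprS -mulrA => Kg; apply: idealM.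
  have iy := principal_ideal (rho y ^+ N).
  apply: contrapT => nKf; apply: irr.
  exists (u N), (ideal_add K [set r * rho y ^+ N | r in setT]); split => //.
  - exact: ideal_add_ideal.
  - split; first by move=> g Kg; apply: idealM.
    by move=> /(_ f) uK; apply: nKf; apply: uK; apply: (HN 1%N); rewrite /u /= expr1.
  - split; first exact: ideal_addl.
    move=> /(_ (rho y ^+ N)) H; apply: ny; exists N; apply: H.
    by apply: ideal_addr => //; exists 1 => //; rewrite mul1r.
  - move=> g ug [k Kk [_ [r _ <-] defg]].
    have : u (N + N)%N r.
      rewrite /u /= exprD -mulrA [_ * r]mulrC.
      rewrite (_ : r * _ = g - k); last by rewrite -defg addrC addKr.
      by rewrite mulrBr; apply: idealB => //; apply: idealM.
    move=> /HN; rewrite /u /= mulrC => Kr.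
    by rewrite -defg; apply: idealD.
case: (pselect (M `<=` nilp)) => [Mnilp|nM].
  exists nil; split => // y _ f _ s /Mnilp[N KN].
  by exists N; apply: is_idealMr.
exists [:: nilp]; split.
  move=> _ [<-|//]; split => //; split => // [[N]|a b [N]].
    rewrite rmorph1 expr1n => K1; apply: nM => s _; exists 0%N.
    by rewrite expr0.
  rewrite rmorphM exprMn => Kab; apply: contrapT => /not_orP[na nb].
  apply: nb; exists N; move: (rho b ^+ N) Kab => z.
  elim: N => [|N IHN]; first by rewrite expr0 mul1r.
  by rewrite exprS -mulrA => /(regular _ _ na).
move=> y Hy f Kyf s Ms; exists 0%N; rewrite expr0 mul1r.
by apply: (regular y) => // ny; apply: (Hy nilp) => //; left.
Qed.

Lemma torsion_avoidance (M : set R) (K : set P) : is_ideal M -> is_ideal K ->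
  exists2 y, M y & forall f, K (rho y * f) ->
    forall s, M s -> exists N, K (rho s ^+ N * f).
Proof.
move=> iM iK; have [Qs [HQ H]] := torsion_primes iM iK.
by have [y My Qy] := prime_avoidance iM HQ; exists y => //; apply: H.
Qed.

End TorsionAvoidance.

(** One element [y] serves all powers of [J] at once: the successive quotients
    [J ^ n / J ^ n.+1] are the degrees of the associated graded ring, a quotient
    of the Noetherian Rees ring. *)
Lemma power_torsion_avoidance (R : comNzRingType) (J M : set R) :
  noetherian R -> is_ideal J -> is_ideal M ->
  exists2 y, M y & forall n a, ideal_exp J n (y * a) ->
    forall s, M s -> exists N, ideal_exp J n (s ^+ N * a).
Proof.
move=> noethR iJ iM.
have [P [rho [ev [noethP evrho evJ evs]]]] := rees noethR iJ.
have iJn n := @ideal_exp_ideal R J n.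
pose K := [set f : P | forall n, ideal_exp J n.+1 (ev f)`_n].
have iK : is_ideal K.
  split; first by move=> n; rewrite rmorph0 coef0; case: (iJn n.+1).
  move=> a f g Kf Kg n; rewrite rmorphD rmorphM /= coefD.
  apply: (idealD (iJn n.+1)) => //; rewrite coefM.
  apply: (ideal_sum _ (iJn n.+1)) => // -[i /= lei] _.
  have := ideal_expD (evJ a i) (Kf (n - i)%N).
  by rewrite (_ : (i + (n - i).+1)%N = n.+1); [apply | lia].
have [y My Hy] := torsion_avoidance rho noethP iM iK; exists y => // n a Jya s Ms.
have Kmon j b : ideal_exp J j.+1 b -> forall f, ev f = b *: 'X^j -> K f.
  move=> Jb f Ef k; rewrite Ef coefZ coefXn; case: eqP => [->|_].
    by rewrite mulr1.
  by rewrite mulr0; case: (iJn k.+1).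
have: forall j, (j <= n)%N -> exists N, ideal_exp J j (s ^+ N * a).
  elim=> [|j IH] lejn; first by exists 0%N.
  have [N JN] := IH (ltnW lejn).
  have [f Ef] := evs _ _ JN.
  have [|N' KN'] := Hy f _ s Ms.
    apply: (Kmon j (y * (s ^+ N * a))).
      by apply: (ideal_exp_le lejn); rewrite mulrCA; apply: (idealM _ (iJn n)).
    by rewrite rmorphM evrho Ef mul_polyC scalerA.
  exists (N' + N)%N; have := KN' j.
  by rewrite rmorphM rmorphXn evrho Ef -rmorphXn /= mul_polyC scalerA coefZ coefXn
    eqxx mulr1 exprD mulrA.
exact.
Qed.

(** * Localization at a prime *)

Section LocalizationTheory.
Variables (R : comNzRingType) (p : prime_idealr R).
Implicit Types (J K P : set R).
Local Notation tau := (@to_loc R p).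
Local Notation Rp := (localization p).

Lemma to_loc_unit s : s \notin p -> exists t : Rp, tau s * t = 1.
Proof.
move=> ps; pose s' : denom p := exist (fun x : R => x \notin p) s ps.
exists (\pi_Rp (1, s')); rewrite /to_loc -[LHS]/(loc_mul _ _) loc_mulE.
by apply/loc_piP; exists (denom1 p) => /=; ring.
Qed.

Lemma loc_frac (x : Rp) : exists a s t,
  [/\ s \notin p, tau s * t = 1 & x = tau a * t].
Proof.
elim/quotW: x => -[a s]; have [t st] := to_loc_unit (valP s).
exists a, (sval s), t; split=> //; first exact: (valP s).
have -> : \pi_Rp (a, s) = \pi_Rp (a, s) * (tau (sval s) * t) by rewrite st mulr1.
rewrite mulrA; congr (_ * t).
rewrite /to_loc -[LHS]/(loc_mul _ _) loc_mulE.
by apply/loc_piP; exists (denom1 p) => /=; ring.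
Qed.

Lemma to_loc_eq0 a : tau a = 0 -> exists2 s, s \notin p & s * a = 0.
Proof.
move=> /loc_piP[u] /=; rewrite mulr1 mul0r mulr0 => ua.
by exists (sval u) => //; apply: (valP u).
Qed.

Lemma ideal_ext_locP J x : is_ideal J -> ideal_ext tau J x <->
  exists a t, J a /\ x = tau a * t.
Proof.
move=> iJ; split=> [|[a [t [Ja ->]]]]; last first.
  by apply: (is_idealMr _ (ideal_ext_ideal _ _)); apply: ideal_ext_mem.
move: x; pose L := [set x : Rp | exists a t, J a /\ x = tau a * t].
suff: ideal_ext tau J `<=` L by [].
apply: ideal_ext_min => [|a Ja]; last by exists a, 1; rewrite mulr1.
apply: is_idealP.
- by exists 0, 0; rewrite mulr0; split => //; case: iJ.
- move=> _ _ [a [t [Ja ->]]] [b [t' [Jb ->]]].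
  have [c [s [v [ps sv ->]]]] := loc_frac t.
  have [c' [s' [v' [ps' sv' ->]]]] := loc_frac t'.
  exists (a * c * s' + b * c' * s), (v * v'); split.
    by apply: idealD => //; do 2![apply: is_idealMr => //].
  rewrite rmorphD !rmorphM mulrDl; congr (_ + _).
    by rewrite mulrACA sv' mulr1 mulrA.
  by rewrite [v * v']mulrC mulrACA sv mulr1 mulrA.
- move=> x _ [a [t [Ja ->]]]; exists a, (x * t); split => //.
  by rewrite mulrCA.
Qed.

Lemma to_loc_ext J a : is_ideal J ->
  ideal_ext tau J (tau a) <-> exists2 s, s \notin p & J (s * a).
Proof.
move=> iJ; split=> [/(ideal_ext_locP _ iJ)[b [x [Jb defa]]]|[s ps Jsa]].
  have [c [s [t [ps st defx]]]] := loc_frac x.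
  have [|u pu uE] := @to_loc_eq0 (s * a - b * c).
    rewrite rmorphB !rmorphM /= defa defx.
    by rewrite mulrCA [tau s * _]mulrCA st mulr1 subrr.
  exists (u * s); first by rewrite prime_idealrM negb_or pu.
  rewrite -mulrA; apply: (@idealBr _ _ _ (u * (b * c))) => //.
    by rewrite -mulrBr uE; case: iJ.
  by apply: idealM => //; apply: is_idealMr.
have [t st] := to_loc_unit ps.
rewrite -[tau a]mulr1 -st mulrCA mulrA -rmorphM.
by apply: (is_idealMr _ (ideal_ext_ideal _ _)); apply: ideal_ext_mem.
Qed.

Lemma ext_preimage_loc (K : set Rp) : is_ideal K ->
  ideal_ext tau (tau @^-1` K) = K.
Proof.
move=> iK; apply/seteqP; split; first exact: ideal_ext_min.
move=> x Kx; have [a [s [t [ps st defx]]]] := loc_frac x.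
rewrite defx; apply: (is_idealMr _ (ideal_ext_ideal _ _)).
apply: ideal_ext_mem => /=; suff -> : tau a = x * tau s by apply: is_idealMr.
by rewrite defx -mulrA [t * _]mulrC st mulr1.
Qed.

Lemma noetherian_loc : noetherian R -> noetherian Rp.
Proof.
move=> noethR K iK; have [s Es] := noethR _ (preimage_ideal tau iK).
exists [seq tau a | a <- s]; rewrite -{1}(ext_preimage_loc iK) Es.
have iS := @ideal_span_ideal _ [set` [seq tau a | a <- s]].
apply/seteqP; split.
  apply: ideal_ext_min => //.
  suff: ideal_span [set` s] `<=`
        tau @^-1` ideal_span [set` [seq tau a | a <- s]] by [].
  apply: ideal_span_min; first exact: preimage_ideal.
  by move=> a /= sa; apply: sub_ideal_span; apply: map_f.
apply: ideal_span_min => [|_ /mapP[a sa ->]]; first exact: ideal_ext_ideal.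
by apply: ideal_ext_mem; apply: sub_ideal_span.
Qed.

Lemma is_local_loc : is_local (ideal_ext tau [set` p]).
Proof.
have ip := idealr_is_ideal p; split; first exact: ideal_ext_ideal.
  rewrite -(rmorph1 tau) => /(to_loc_ext _ ip)[s ps].
  by rewrite /= mulr1; apply/negP.
move=> x; have [a [s [t [ps st ->]]]] := loc_frac x => nax.
have [pa|pa] := boolP (a \in p).
  by case: nax; apply: (is_idealMr _ (ideal_ext_ideal _ _)); apply: ideal_ext_mem.
have [u au] := to_loc_unit pa; exists (u * tau s).
by rewrite mulrACA au [t * _]mulrC st mulr1.
Qed.

Lemma loc_maxE : [set` @loc_max R p] = ideal_ext tau [set` p].
Proof. by apply/seteqP; split=> x /=; move/loc_maxP. Qed.

(** An element of the contraction is multiplied into [P] by some [s] outside of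
    [p], hence outside of [P]. *)
Lemma ext_prime_loc P : is_prime P -> P `<=` [set` p] ->
  is_prime (ideal_ext tau P) /\ tau @^-1` (ideal_ext tau P) = P.
Proof.
move=> pP Pp; have [iP P1 PM] := pP.
have cont : tau @^-1` (ideal_ext tau P) = P.
  apply/seteqP; split=> a /=; last exact: ideal_ext_mem.
  move=> /(to_loc_ext _ iP)[s ps /PM[/Pp /= sp|//]].
  by rewrite sp in ps.
split=> //; split; first exact: ideal_ext_ideal.
  rewrite -(rmorph1 tau) => H; apply: P1; rewrite -cont; exact: H.
move=> x y; have [a [s [t [ps st ->]]]] := loc_frac x.
have [b [s' [t' [ps' st' ->]]]] := loc_frac y => Pxy.
have iE := @ideal_ext_ideal _ _ tau P.
have : P (a * b).
  rewrite -cont /= rmorphM.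
  have -> : tau a * tau b = tau s * tau s' * (tau a * t * (tau b * t')).
    suff E (A : comNzRingType) (x' y' z u w v : A) : z * u = 1 -> w * v = 1 ->
        x' * y' = z * w * (x' * u * (y' * v)) by apply: E.
    move=> zu wv; transitivity ((z * u) * (w * v) * (x' * y')); last by ring.
    by rewrite zu wv !mul1r.
  exact: (idealM _ iE).
by case/PM=> ?; [left|right]; apply: (is_idealMr _ iE); apply: ideal_ext_mem.
Qed.

End LocalizationTheory.

(** * Completion *)

Section RingIdentities.
Variable A : comNzRingType.
Implicit Types x y z t : A.

Lemma sub_via x y z t : z - t = (x - y) - (x - z) + (y - t).
Proof. ring. Qed.

Lemma sub_mul_add x y z t u : z * x + y - (z * t + u) = z * (x - t) + (y - u).
Proof. ring. Qed.

Lemma sub_mul_mul x y z t : x * y - z * t = x * (y - t) + t * (x - z).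
Proof. ring. Qed.

End RingIdentities.

Section CompletionFiltration.
Variables (B : comNzRingType) (n : idealr B).
Local Notation N := [set` n].
Local Notation C := (completion n).
Local Notation iota := (to_completion n).
Local Notation piC := (\pi_({ideal_quot (@null_pred B n)})).

(** The closure of the [k]-th power of the extension of [n]. *)
Definition fil k : set C := [set x | exists2 u : cauchy_seq n, x = piC u &
  exists M : nat, forall i, (M <= i)%N -> ideal_exp N k (u i)].

Lemma piC_surj (x : C) : exists u : cauchy_seq n, x = piC u.
Proof. by exists (repr (x : {ideal_quot (@null_pred B n)})); rewrite reprK. Qed.

Lemma piC_eq (u v : cauchy_seq n) : piC u = piC v -> is_null n (u - v).
Proof.
by move=> /eqP; rewrite -Quotient.idealrBE => /nullP.
Qed.

Lemma piC_eq0 (u : cauchy_seq n) : is_null n u -> piC u = 0.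
Proof.
move=> nu; rewrite -(rmorph0 piC); apply/eqP; rewrite -Quotient.idealrBE subr0.
exact/nullP.
Qed.

Let iN k := @ideal_exp_ideal B N k.

Lemma fil_pi k (u : cauchy_seq n) :
  fil k (piC u) -> exists M, forall i, (M <= i)%N -> ideal_exp N k (u i).
Proof.
move=> [v /piC_eq uv [M vM]]; have [M' uvM] := uv k.
exists (maxn M M') => i; rewrite geq_max => /andP[Mi M'i].
by apply: (idealBr (iN k) _ (vM i Mi)); apply: uvM.
Qed.

Lemma fil_ideal k : is_ideal (fil k).
Proof.
split; first by exists 0; rewrite ?rmorph0 //; exists 0%N => i _; case: (iN k).
move=> a _ _ [u -> [M uM]] [v -> [M' vM]]; have [w ->] := piC_surj a.
exists (w * u + v); first by rewrite -rmorphM -rmorphD.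
exists (maxn M M') => i; rewrite geq_max => /andP[Mi M'i].
exact: (iN k).2 (uM i Mi) (vM i M'i).
Qed.

Lemma fil0 x : fil 0 x.
Proof. by have [u ->] := piC_surj x; exists u => //; exists 0%N. Qed.

Lemma fil_le k l : (k <= l)%N -> fil l `<=` fil k.
Proof.
move=> le _ [u -> [M uM]]; exists u => //; exists M => i /uM.
exact: ideal_exp_le.
Qed.

Lemma filM k l x y : fil k x -> fil l y -> fil (k + l) (x * y).
Proof.
move=> [u -> [M uM]] [v -> [M' vM]]; exists (u * v); first by rewrite -rmorphM.
exists (maxn M M') => i; rewrite geq_max => /andP[Mi M'i].
exact: ideal_expD (uM i Mi) (vM i M'i).
Qed.

Lemma fil_iota k b : fil k (iota b) <-> ideal_exp N k b.
Proof.
split; first by move=> /fil_pi[M /(_ M (leqnn M))].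
by move=> kb; exists (CauchySeq (const_cauchy n b)) => //; exists 0%N.
Qed.

Lemma fil_dense k x : exists b, fil k (x - iota b).
Proof.
have [u ->] := piC_surj x; have [M uM] := cauchyP _ _ (valP u) k.
exists (u M); exists (u - CauchySeq (const_cauchy n (u M))); first by rewrite rmorphB.
by exists M => i Mi; apply: uM.
Qed.

Lemma fil_sep x : (forall k, fil k x) -> x = 0.
Proof.
have [u ->] := piC_surj x => H; apply: piC_eq0 => k.
exact: fil_pi (H k).
Qed.

(** The approximations of the partial sums by elements of the base ring form a
    Cauchy sequence. *)
Lemma fil_complete (c : nat -> C) : (forall i, fil i (c i)) ->
  exists x, forall k, fil k (x - \sum_(i < k) c i).
Proof.
move=> Fc; pose s k := \sum_(i < k) c i.
have [b Hb] := choice (fun k => fil_dense k (s k)).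
have iF k := fil_ideal k.
have sS k l : (k <= l)%N -> fil k (s l - s k).
  move=> /subnK <-; elim: (l - k)%N => [|j IH].
    by rewrite subrr; case: (iF k).
  rewrite addSn /s big_ord_recr /= addrAC; apply: (idealD (iF k)) => //.
  by apply: (fil_le (leq_addl j k)).
have bb k l : (k <= l)%N -> ideal_exp N k (b l - b k).
  move=> le; apply/fil_iota; rewrite rmorphB.
  rewrite (sub_via (s l) (s k)); apply: (idealD (iF k)) => //.
  by apply: (idealB (iF k)); [exact: sS | exact: (fil_le le)].
have cb : b \in cauchy_pred n.
  apply/cauchyP => k; exists k => i j ki kj.
  rewrite (_ : b i - b j = (b i - b k) - (b j - b k)); last by ring.
  by apply: (idealB (iN k)); apply: bb.
exists (piC (CauchySeq cb)) => k.
apply: (@idealBr _ _ _ (- (s k - iota (b k))) (iF k)); last exact: (idealN (iF k)).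
rewrite opprK addrA subrK; exists (CauchySeq cb - CauchySeq (const_cauchy n (b k))).
  by rewrite rmorphB.
by exists k => i ki; apply: bb.
Qed.

(** Successive approximation: if [f] corrects every error of order [d + i] up to
    order [d + i + 1] with coefficients of order [i], the corrections converge. *)
Lemma fil_gen d (L : set C) (f : seq C) : is_ideal L ->
  (forall g, g \in f -> L g) ->
  (forall i x, L x -> fil (d + i) x -> exists2 c : nat -> C,
     forall j, fil i (c j) & fil (d + i).+1 (x - \sum_(j < size f) c j * f`_j)) ->
  forall x, L x -> fil d x -> ideal_span [set` f] x.
Proof.
move=> iL Lf H x Lx Fx.
pose S := {z : nat * C | L z.2 /\ fil (d + z.1) z.2}.
have sumL (c : nat -> C) : L (\sum_(j < size f) c j * f`_j).
  apply: (ideal_sum _ iL) => j _; apply: (idealM _ iL); apply: Lf.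
  exact: mem_nth.
have step (z : nat * C) : exists c : nat -> C, L z.2 -> fil (d + z.1) z.2 ->
    (forall j, fil z.1 (c j)) /\ fil (d + z.1).+1 (z.2 - \sum_(j < size f) c j * f`_j).
  case: (pselect (L z.2 /\ fil (d + z.1) z.2)) => [[Lz Fz]|nz].
    by have [c c1 c2] := H _ _ Lz Fz; exists c.
  by exists (fun=> 0) => *; case: nz.
have [c Hc] := choice step.
pose xs := fix xs i := if i is j.+1 then
  xs j - \sum_(l < size f) c (j, xs j) l * f`_l else x.
have xsP i : L (xs i) /\ fil (d + i) (xs i).
  elim: i => [|i [Li Fi]]; first by rewrite addn0.
  split; first exact: (idealB iL).
  by rewrite addnS; have [_] := Hc (i, xs i) Li Fi.
have cF i l : fil i (c (i, xs i) l).
  by have [Li Fi] := xsP i; have [/(_ l)] := Hc (i, xs i) Li Fi.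
have lim l : exists y, forall k, fil k (y - \sum_(i < k) c (i : nat, xs i) l).
  by apply: (@fil_complete (fun i => c (i, xs i) l)).
have [y Hy] := choice lim.
have iS := @ideal_span_ideal _ [set` f].
suff -> : x = \sum_(l < size f) y l * f`_l.
  apply: (ideal_sum _ iS) => l _; apply: (idealM _ iS); apply: sub_ideal_span.
  exact: mem_nth.
apply/eqP; rewrite -subr_eq0; apply/eqP; apply: fil_sep => k.
have defx : x = xs k + \sum_(l < size f) (\sum_(i < k) c (i : nat, xs i) l) * f`_l.
  elim: k => [|k IH].
    by rewrite big1 ?addr0 // => l _; rewrite big_ord0 mul0r.
  under eq_bigr do rewrite big_ord_recr mulrDl /=.
  by rewrite big_split /= addrCA subrK addrC -IH.
rewrite defx -addrA -sumrB; apply: (idealD (fil_ideal k)).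
  by apply: fil_le (xsP k).2; rewrite leq_addl.
apply: (ideal_sum _ (fil_ideal k)) => l _; rewrite -mulrBl.
apply: (is_idealMr _ (fil_ideal k)); rewrite -opprB.
exact: (idealN (fil_ideal k)).
Qed.

Hypothesis noethB : noetherian B.

(** The coefficients of the errors along generators of [n] have increasing order,
    so that successive approximation applies. *)
Lemma fil1E : fil 1 = ideal_ext iota N.
Proof.
have iNN := idealr_is_ideal n; have iE := @ideal_ext_ideal _ _ iota N.
apply/seteqP; split; last first.
  apply: ideal_ext_min; first exact: fil_ideal.
  by move=> b nb; apply/fil_iota; rewrite ideal_exp1.
have [s Es] := noethB iNN.
have sub : ideal_span [set` [seq iota b | b <- s]] `<=` ideal_ext iota N.
  apply: ideal_span_min => // _ /mapP[b bs ->]; apply: ideal_ext_mem.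
  by rewrite Es; apply: sub_ideal_span.
move=> x Fx; apply: sub; apply: (@fil_gen 1 setT) Fx => // i {}x _ Fx.
have [b Hb] := fil_dense (1 + i).+1 x.
have Fb : fil (i + 1) (iota b).
  rewrite addnC -(subKr x (iota b)); apply: (idealB (fil_ideal _)) => //.
  by apply: fil_le Hb.
have := ideal_expD_sub ((fil_iota _ _).1 Fb).
rewrite ideal_exp1 // {2}Es => /(ideal_mul_span (iN i))[c ic defb].
exists (fun j => iota (c j)); first by move=> j; apply/fil_iota.
rewrite size_map; suff <- : iota b = \sum_(j < size s) iota (c j) * [seq iota b | b <- s]`_j by [].
rewrite defb rmorph_sum; apply: eq_bigr => j _.
by rewrite rmorphM (nth_map 0).
Qed.

(** The initial forms of the members of an ideal [L] form a graded ideal of the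
    Rees algebra of [n], generated in degrees at most [d].  Lifts of generators in
    degree [d] generate the part of [L] in [fil d], and finitely many more take
    care of the lower orders. *)
Lemma noetherian_completion : noetherian C.
Proof.
move=> L iL; have iNN := idealr_is_ideal n.
have iF k := fil_ideal k.
pose K k := [set b | ideal_exp N k b /\ exists2 x, L x & fil k.+1 (x - iota b)].
have iK k : is_ideal (K k).
  split; first by split; [case: (iN k)|exists 0; [case: iL|rewrite rmorph0 subrr; case: (iF k.+1)]].
  move=> a b c [Nb [x Lx Fx]] [Nc [y Ly Fy]]; split; first exact: (iN k).2.
  exists (iota a * x + y); first exact: iL.2.
  by rewrite rmorphD rmorphM sub_mul_add; apply: (iF k.+1).2.
have [|k a b Na [Nb [x Lx Fx]]|d Hd] := graded_stable noethB iNN iK.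
- by move=> k b [].
- split; first exact: ideal_mulM.
  exists (iota a * x); first exact: (idealM _ iL).
  rewrite rmorphM -mulrBr -add1n; apply: filM => //.
  by apply/fil_iota; rewrite ideal_exp1.
have lift k : exists f : seq C, (forall g, g \in f -> L g) /\
   forall i b, ideal_mul (ideal_exp N i) (K k) b ->
     exists2 c : nat -> C, forall j, fil i (c j) &
       fil (k + i).+1 (iota b - \sum_(j < size f) c j * f`_j).
  have [s Es] := noethB (iK k).
  have [F HF] : {F : B -> C & forall b, b \in s -> L (F b) /\ fil k.+1 (F b - iota b)}.
    apply: (@choice _ _ (fun b x => b \in s -> L x /\ fil k.+1 (x - iota b))) => b.
    case: (pselect (K k b)) => [[_ [x Lx Fx]]|nK]; first by exists x.
    by exists 0 => bs; case: nK; rewrite Es; apply: sub_ideal_span.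
  exists [seq F b | b <- s]; split; first by move=> _ /mapP[b /HF[Lb _] ->].
  move=> i b; rewrite Es => /(ideal_mul_span (iN i))[c ic ->].
  exists (fun j => iota (c j)); first by move=> j; apply/fil_iota.
  rewrite size_map rmorph_sum -sumrB; apply: (ideal_sum _ (iF _)) => j _.
  rewrite (nth_map 0) // rmorphM -mulrBr -opprB mulrN addnC -addnS.
  apply: (idealN (iF _)); apply: filM; first by apply/fil_iota.
  by apply: (HF _ _).2; apply: mem_nth.
have initial k x : L x -> fil k x -> exists2 b, K k b & fil k.+1 (x - iota b).
  move=> Lx Fx; have [b Hb] := fil_dense k.+1 x; exists b => //; split; last by exists x.
  apply/fil_iota; rewrite -(subKr x (iota b)); apply: (idealB (iF k)) => //.
  by apply: fil_le Hb.
suff fg j : (j <= d)%N -> exists f : seq C, (forall g, g \in f -> L g) /\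
    forall x, L x -> fil (d - j) x -> ideal_span [set` f] x.
  have [f [fL Lf]] := fg d (leqnn d); exists f; apply/seteqP; split.
    by move=> x Lx; apply: Lf => //; rewrite subnn; apply: fil0.
  exact: ideal_span_min.
elim: j => [_|j IH ltjd].
  have [f [fL Hf]] := lift d; exists f; split => // x Lx; rewrite subn0.
  apply: (fil_gen iL fL) Lx => i {}x Lx Fx.
  have [b Kb Fb] := initial _ _ Lx Fx.
  have [c Fc Hc] := Hf i b (Hd _ _ Kb); exists c => //.
  by rewrite -(subrKA (iota b)); apply: (idealD (iF _)).
have [f [fL Hf]] := IH (ltnW ltjd).
have [f' [f'L Hf']] := lift (d - j.+1)%N.
exists (f' ++ f); split.
  by move=> g; rewrite mem_cat => /orP[/f'L|/fL].
move=> x Lx Fx; have iS := @ideal_span_ideal _ [set` f' ++ f].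
have [b Kb Fb] := initial _ _ Lx Fx.
have [|c _ Hc] := Hf' 0%N b; first by rewrite -[b]mul1r; apply: ideal_mulM.
rewrite addn0 in Hc.
set y := \sum_(_ < _) _ in Hc.
have Ly : L y.
  apply: (ideal_sum _ iL) => l _; apply: (idealM _ iL); apply: f'L; exact: mem_nth.
rewrite -(subrK y x); apply: (idealD iS).
  apply: (@ideal_span_sub _ [set` f]).
    by move=> g /= gf; rewrite mem_cat gf orbT.
  apply: Hf; first exact: (idealB iL).
  rewrite subnSK // in Fb Hc.
  by rewrite -(subrKA (iota b)); apply: (idealD (iF _)).
apply: (ideal_sum _ iS) => l _; apply: (idealM _ iS); apply: sub_ideal_span.
by rewrite /= mem_cat mem_nth.
Qed.

Hypothesis locN : is_local N.

Lemma is_local_completion : is_local (fil 1).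
Proof.
have [_ N1 Nu] := locN; have iNN := idealr_is_ideal n.
split; first exact: fil_ideal.
  by rewrite -(rmorph1 iota) => /fil_iota; rewrite ideal_exp1.
move=> x nFx; have [b Fb] := fil_dense 1 x.
have nb : ~ N b.
  move=> Nb; apply: nFx; apply: (idealBr (fil_ideal 1) Fb).
  by apply/fil_iota; rewrite ideal_exp1.
have [b' bb'] := Nu b nb.
(* [x * iota b' = 1 - e] with [e] in [fil 1], and the geometric series of [e]
   converges *)
pose e := 1 - x * iota b'.
have Fe : fil 1 e.
  rewrite /e -(rmorph1 iota) -bb' rmorphM -mulrBl -opprB.
  by apply: (is_idealMr _ (fil_ideal 1)); apply: (idealN (fil_ideal 1)).
have FeX k : fil k (e ^+ k).
  elim: k => [|k IH]; first exact: fil0.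
  by rewrite exprS -add1n; apply: filM.
have [y Hy] := fil_complete FeX.
exists (iota b' * y); rewrite mulrA -(subKr 1 (x * iota b')) -/e.
apply/eqP; rewrite -subr_eq0; apply/eqP; apply: fil_sep => k.
rewrite -(subrK (\sum_(i < k) e ^+ i) y) mulrDr -addrA.
apply: (idealD (fil_ideal k)); first by apply: (idealM _ (fil_ideal k)).
have -> : (1 - e) * (\sum_(i < k) e ^+ i) - 1 = - e ^+ k.
  by rewrite -[1 - e]opprB mulNr -subrX1 opprB addrAC subrr add0r.
exact: (idealN (fil_ideal k)).
Qed.

(** The coefficients of an element of the extended ideal can be approximated by
    elements of the base ring. *)
Lemma ext_fil J k b : is_ideal J ->
  ideal_add (ideal_ext iota J) (fil k) (iota b) -> ideal_add J (ideal_exp N k) b.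
Proof.
move=> iJ [x + [y Fy]].
have iF := fil_ideal k.
pose G := [set x | exists2 a, J a & fil k (x - iota a)].
have iG : is_ideal G.
  apply: is_idealP.
  - by exists 0; [case: iJ | rewrite rmorph0 subrr; case: iF].
  - move=> u v [a Ja Fa] [c Jc Fc]; exists (a + c); first exact: idealD.
    by rewrite rmorphD opprD addrACA; apply: (idealD iF).
  - move=> r u [a Ja Fa]; have [r' Fr] := fil_dense k r.
    exists (r' * a); first exact: idealM.
    by rewrite rmorphM sub_mul_mul; apply: (idealD iF); apply: (idealM _ iF).
suff: ideal_ext iota J `<=` G.
  move=> /[apply] -[a Ja Fa] defb; exists a => //; exists (b - a); last by rewrite addrC subrK.
  apply/fil_iota; rewrite rmorphB /= -defb addrAC; exact: (idealD iF).
apply: ideal_ext_min => // a Ja; exists a => //; rewrite subrr; by case: iF.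
Qed.

Lemma ext_contract J b : is_ideal J -> ideal_ext iota J (iota b) -> J b.
Proof.
move=> iJ Jb; apply: (krull_intersection noethB locN iJ) => k.
by apply: ext_fil => //; apply: ideal_addl => //; apply: fil_ideal.
Qed.

End CompletionFiltration.

Section CompletionMap.
Variables (R S : comNzRingType) (f : {rmorphism R -> S}) (n : idealr R) (n' : idealr S).
Hypothesis f_exp : forall k x, ideal_exp [set` n] k x -> ideal_exp [set` n'] k (f x).
Hypothesis f_exp_inv : forall k x, ideal_exp [set` n'] k (f x) -> ideal_exp [set` n] k x.
Hypothesis f_surj : forall y, exists x, f x = y.

(** To be applied to the isomorphism between a local ring and its localization at
    the maximal ideal. *)
Lemma completion_map : exists phi : {rmorphism completion n -> completion n'},
  [/\ forall x, phi (to_completion n x) = to_completion n' (f x),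
      forall y, exists x, phi x = y & forall x, phi x = 0 -> x = 0].
Proof.
pose pin := \pi_({ideal_quot (@null_pred R n)}).
pose pin' := \pi_({ideal_quot (@null_pred S n')}).
have fc (u : cauchy_seq n) : (f \o u) \in cauchy_pred n'.
  apply/cauchyP => k; have [M uM] := cauchyP _ _ (valP u) k; exists M => i j Mi Mj.
  by rewrite /= -rmorphB; apply: f_exp; apply: uM.
pose psi u := CauchySeq (fc u).
pose phi (x : completion n) : completion n' :=
  pin' (psi (repr (x : {ideal_quot (@null_pred R n)}))).
have phiE u : phi (pin u) = pin' (psi u).
  rewrite /phi; set v := repr _.
  have /piC_eq nvu : pin v = pin u by rewrite /pin reprK.
  apply/eqP.
  rewrite -subr_eq0 -rmorphB; apply/eqP; apply: piC_eq0 => k.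
  have [M Mvu] := nvu k; exists M => i Mi.
  have : ideal_exp [set` n'] k (f (v i - u i)) by apply: f_exp; exact: (Mvu i Mi).
  by rewrite rmorphB.
have phiB : zmod_morphism phi.
  move=> x y; have [u ->] := piC_surj x; have [v ->] := piC_surj y.
  rewrite -rmorphB !phiE -rmorphB; congr (pin' _); apply: val_inj.
  by apply: funext => i /=; rewrite rmorphB.
have phiM : monoid_morphism phi.
  split=> [|x y].
    rewrite -(rmorph1 pin) phiE -(rmorph1 pin'); congr (pin' _); apply: val_inj.
    by apply: funext => i /=; rewrite rmorph1.
  have [u ->] := piC_surj x; have [v ->] := piC_surj y.
  rewrite -rmorphM !phiE -rmorphM; congr (pin' _); apply: val_inj.
  by apply: funext => i /=; rewrite rmorphM.
pose H1 := GRing.isZmodMorphism.Build (completion n) (completion n') phi phiB.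
pose H2 := GRing.isMonoidMorphism.Build (completion n) (completion n') phi phiM.
exists (HB.pack phi H1 H2 : {rmorphism completion n -> completion n'}); split.
- move=> x /=; rewrite /to_completion phiE; congr (pin' _); exact: val_inj.
- move=> y; have [v ->] := piC_surj y; have [g Hg] := choice f_surj.
  have gc : (g \o v) \in cauchy_pred n.
    apply/cauchyP => k; have [M vM] := cauchyP _ _ (valP v) k; exists M => i j Mi Mj.
    by apply: f_exp_inv; rewrite rmorphB /= !Hg; apply: vM.
  exists (pin (CauchySeq gc)); rewrite /= phiE; congr (pin' _); apply: val_inj.
  by apply: funext => i /=; rewrite Hg.
- move=> x; have [u ->] := piC_surj x; rewrite /= phiE -(rmorph0 pin') => /piC_eq nu.
  apply: piC_eq0 => k; have [M uM] := nu k; exists M => i Mi; apply: f_exp_inv.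
  by have := uM i Mi; rewrite subr0.
Qed.

End CompletionMap.

(** * Membership in the set of quintasymptotic primes *)

Section RegularElements.
Variable R : comNzRingType.

(** By Artin-Rees, an element regular modulo [L] divides approximately as well. *)
Lemma regular_approx (n L : set R) (y : R) : noetherian R -> is_ideal n ->
  is_ideal L -> (forall x, L (y * x) -> L x) ->
  forall k, exists d, forall b, ideal_add L (ideal_exp n (d + k)) (y * b) ->
    ideal_add L (ideal_exp n k) b.
Proof.
move=> noethR iN iL reg k.
have iy := principal_ideal y.
pose D := ideal_add L [set r * y | r in setT].
have iD : is_ideal D by apply: ideal_add_ideal.
have [d Hd] := artin_rees noethR iN iD.
exists d => b [l Ll [e Ne defyb]].
have De : D e.
  rewrite (_ : e = y * b - l); last by rewrite -defyb addrC addKr.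
  apply: (idealB iD); last exact: ideal_addl.
  by apply: ideal_addr => //; exists b => //; rewrite mulrC.
have iNk := @ideal_exp_ideal R n k.
suff sub : ideal_mul (ideal_exp n k) D `<=`
    [set x | exists2 e1, ideal_exp n k e1 & L (x - y * e1)].
  have [e1 Ne1 Le1] := sub _ (Hd k e (conj Ne De)).
  exists (b - e1); last by exists e1; rewrite ?subrK.
  apply: reg; rewrite mulrBr -defyb -addrA; exact: idealD.
apply: ideal_mul_min => [|a _ Na [l' Ll' [_ [r _ <-] <-]]].
  apply: is_idealP; first by exists 0; [case: iNk | rewrite mulr0 subrr; case: iL].
    move=> x x' [u Nu Lu] [v Nv Lv]; exists (u + v); first exact: (idealD iNk).
    by rewrite mulrDr opprD addrACA; apply: idealD.
  move=> c x [u Nu Lu]; exists (c * u); first exact: (idealM _ iNk).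
  by rewrite mulrCA -mulrBr; apply: idealM.
exists (r * a); first exact: (idealM _ iNk).
rewrite (_ : _ - _ = a * l'); first exact: idealM.
by rewrite mulrDr (_ : y * (r * a) = a * (r * y)) ?addrK //; ring.
Qed.

End RegularElements.

Section LocalCompletion.
Variables (A : comNzRingType) (noethA : noetherian A) (p : prime_idealr A).
Implicit Types (J z : set A).
Local Notation S := (loc_completion p).
Local Notation sigma := (to_loc_completion p).
Local Notation tau := (@to_loc A p).
Local Notation iota := (to_completion (@loc_max A p)).
Local Notation fil := (@fil _ (@loc_max A p)).

Lemma noetherian_loc_completion : noetherian S.
Proof. exact: (@noetherian_completion _ (@loc_max A p) (noetherian_loc noethA)). Qed.

Lemma is_local_loc_max : is_local [set` @loc_max A p].
Proof. by rewrite loc_maxE; apply: is_local_loc. Qed.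

Lemma ext_sigma J : ideal_ext sigma J = ideal_ext iota (ideal_ext tau J).
Proof.
apply/seteqP; split.
  apply: ideal_ext_min; first exact: ideal_ext_ideal.
  by move=> x Jx; apply: ideal_ext_mem; apply: ideal_ext_mem.
apply: ideal_ext_min; first exact: ideal_ext_ideal.
suff: ideal_ext tau J `<=` iota @^-1` (ideal_ext sigma J) by [].
apply: ideal_ext_min; first by apply: preimage_ideal; apply: ideal_ext_ideal.
by move=> x Jx; apply: (@ideal_ext_mem _ _ sigma).
Qed.

Lemma ext_sigma_max : ideal_ext sigma [set` p] = fil 1.
Proof. by rewrite ext_sigma -loc_maxE fil1E //; apply: noetherian_loc. Qed.

Lemma is_local_ext_sigma : is_local (ideal_ext sigma [set` p]).
Proof. by rewrite ext_sigma_max; apply: is_local_completion is_local_loc_max. Qed.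

Lemma ext_sigma_contract J a : is_ideal J ->
  ideal_ext sigma J (sigma a) -> exists2 s, s \notin p & J (s * a).
Proof.
move=> iJ; rewrite ext_sigma => /(ext_contract (@noetherian_loc _ p noethA)
  is_local_loc_max (ideal_ext_ideal _ _)).
by move=> /(to_loc_ext _ _ iJ).
Qed.

Lemma sigma_unit s : s \notin p -> exists t, sigma s * t = 1.
Proof.
move=> /to_loc_unit[t st]; exists (iota t).
by rewrite -[sigma s]/(iota (tau s)) -rmorphM st rmorph1.
Qed.

(** By Krull's intersection theorem, the ideal generated by [z] misses the image
    of the complement of [z].  A prime over this ideal that still misses the image
    contracts to [z], and so does a minimal prime below it. *)
Lemma min_prime_lift z : min_prime_over [set 0] z -> z `<=` [set` p] ->
  exists2 w : set S, min_prime_over [set 0] w & z `<=` sigma @^-1` w.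
Proof.
move=> [pz _ minz] zp; have [iz z1 zM] := pz.
have [|||w [pw _ wW]] := @prime_missing S noetherian_loc_completion
    (ideal_ext sigma z) [set sigma s | s in ~` z] (ideal_ext_ideal _ _).
- by exists 1 => //; rewrite rmorph1.
- move=> _ _ [s zs <-] [t zt <-]; exists (s * t); last by rewrite rmorphM.
  by move=> /zM[].
- move=> x zx [s zs sx]; move: zx; rewrite -sx => /(ext_sigma_contract iz)[t pt /zM[/zp /= pt'|//]].
  by rewrite pt' in pt.
have [|v minv vw] := min_prime_below noetherian_loc_completion (zero_ideal S) pw.
  by move=> x0 ->; case: pw => [[]].
exists v => //; have [pv _ _] := minv.
apply: minz; first exact: preimage_prime.
  by move=> x0 -> /=; rewrite rmorph0; case: pv => [[]].
by move=> x /= /vw wx; apply: contrapT => zx; apply: (wW _ wx); exists x.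
Qed.

(** The witness is a minimal prime of the completion over [z]: modulo [J + z] the
    ideal [p] is already nilpotent, locally at [p]. *)
Lemma quint_prime_of_min J z : is_ideal J -> min_prime_over [set 0] z ->
  min_prime_over (ideal_add J z) [set` p] -> quint_prime J p.
Proof.
move=> iJ minz minp; have [pz _ _] := minz; have [iz _ _] := pz.
have [pp Jzp _] := minp.
have Jp : J `<=` [set` p] by move=> x Jx; apply: Jzp; apply: ideal_addl.
have zp : z `<=` [set` p] by move=> x zx; apply: Jzp; apply: ideal_addr.
have [w [pw _ minw] zw] := min_prime_lift minz zp.
have [w' Ew] := prime_idealr_of pw; have [iw w1 _] := pw.
have locS := is_local_ext_sigma; have iE K := @ideal_ext_ideal _ _ sigma K.
exists w'.
  move=> v /= vw; have := minw _ (prime_idealr_is_prime v).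
  rewrite -Ew; apply=> //; move=> x0 -> /=; exact: idealr0.
rewrite Ew; apply/seteqP; split.
  apply: subset_trans (prime_radical (local_prime locS)); apply: radical_sub.
  apply: ideal_add_min => //; first exact: ideal_ext_sub.
  exact: local_sub.
have iJw : is_ideal (ideal_add (ideal_ext sigma J) w) by apply: ideal_add_ideal.
apply: ideal_ext_min; first exact: radical_ideal.
move=> a pa; have [s [k [ps Jzsa]]] := min_prime_nilp noethA (ideal_add_ideal iJ iz) minp pa.
have [|t st] := @sigma_unit s; first exact/negP.
exists k; rewrite -[_ ^+ _]mul1r -st mulrAC mulrC; apply: (idealM _ iJw).
rewrite -rmorphXn -rmorphM.
suff: ideal_add J z `<=` sigma @^-1` (ideal_add (ideal_ext sigma J) w) by apply.
apply: ideal_add_min; first exact: preimage_ideal.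
  by move=> x Jx /=; apply: ideal_addl => //; apply: ideal_ext_mem.
by move=> x /zw ?; apply: ideal_addr.
Qed.

Lemma quint_prime_sub J : quint_prime J p -> J `<=` [set` p].
Proof.
move=> [z _ rad] x Jx; have ip := idealr_is_ideal p.
have : ideal_ext sigma [set` p] (sigma x).
  rewrite -rad; exists 1%N; rewrite expr1.
  by apply: ideal_addl; [apply: idealr_is_ideal|apply: ideal_ext_mem].
move=> /(ext_sigma_contract ip)[s ps] /=.
by rewrite prime_idealrM (negbTE ps).
Qed.

(** If [p] were in [Q^*(J)] through [z] and contained [y], a power of [y] would be
    [j + w] with [j] in the extension of [J] and [w] in [z].  Some [c] outside of
    [z] is annihilated by a power of [w], so [y ^ T * c] lies in [J * c] and
    [y ^ (T k) * c] in [J ^ k].  As [y] is regular modulo [J ^ k], elements of the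
    localization close to [c] are close to [J ^ k]; hence [c = 0]. *)
Lemma regular_not_quint J y : is_ideal J ->
  (forall k a, ideal_exp J k (y * a) -> exists2 t, t \notin p & ideal_exp J k (t * a)) ->
  quint_prime J p -> y \notin p.
Proof.
move=> iJ reg quint; apply/negP => py; have Jp := quint_prime_sub quint.
have [z minz rad] := quint.
have iE K := @ideal_ext_ideal _ _ sigma K; have iz := idealr_is_ideal z.
have : ideal_ext sigma [set` p] (sigma y) by apply: ideal_ext_mem.
rewrite -rad => -[k [j Jj [w zw defyk]]].
have minz' : min_prime_over [set 0] [set` z].
  split; [exact: prime_idealr_is_prime | by move=> x0 ->; apply: idealr0 |].
  move=> Q pQ _ Qz; have [q Eq] := prime_idealr_of pQ; rewrite -Eq in Qz *.
  exact: minz.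
have [c [h [zc cw0]]] := min_prime_nilp noetherian_loc_completion (zero_ideal S) minz' zw.
pose T := (k * h)%N.
have [j' Jj' yTc] : exists2 j', ideal_ext sigma J j' & sigma y ^+ T * c = j' * c.
  exists (sigma y ^+ T - w ^+ h); last by rewrite mulrBl [w ^+ h * c]mulrC cw0 subr0.
  rewrite /T exprM -defyk subrXX addrK; exact: (is_idealMr _ (iE J)).
have Jkc l : ideal_ext sigma (ideal_exp J l) (sigma (y ^+ (T * l)) * c).
  have -> : sigma (y ^+ (T * l)) * c = j' ^+ l * c.
    elim: l => [|l IH]; first by rewrite muln0 !expr0 rmorph1.
    rewrite mulnS exprD rmorphM mulrAC [sigma (y ^+ T)]rmorphXn yTc.
    by rewrite -mulrA [c * _]mulrC IH mulrA -exprS.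
  apply: (is_idealMr _ (iE _)); apply: ideal_exp_ext; exact: ideal_expX.
suff c0 : c = 0 by apply: zc; rewrite c0; case: iz.
apply: fil_sep => l.
have noethB := @noetherian_loc _ p noethA; have iNN := idealr_is_ideal (@loc_max A p).
have iL := @ideal_ext_ideal _ _ tau (ideal_exp J l); have iJl := @ideal_exp_ideal A J l.
have regX i a : ideal_exp J l (y ^+ i * a) -> exists2 t, t \notin p & ideal_exp J l (t * a).
  elim: i a => [|i IH] a.
    by rewrite expr0 mul1r => Ja; exists 1; rewrite ?idealr1 ?mul1r.
  rewrite exprS -mulrA => /reg[t pt]; rewrite mulrCA => /IH[t' pt' Ja].
  by exists (t' * t); rewrite ?prime_idealrM ?negb_or ?pt' // -mulrA.
have regL x : ideal_ext tau (ideal_exp J l) (tau (y ^+ (T * l)) * x) ->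
    ideal_ext tau (ideal_exp J l) x.
  have [a [s [t [ps st ->]]]] := loc_frac x.
  rewrite mulrA -rmorphM => Lyat.
  have : ideal_ext tau (ideal_exp J l) (tau (y ^+ (T * l) * a)).
    rewrite -[tau _]mulr1 -st [tau s * t]mulrC mulrA; exact: (is_idealMr _ iL).
  move=> /(to_loc_ext _ _ iJl)[u pu]; rewrite mulrCA => /regX[v pv Ja].
  apply: (is_idealMr _ iL); apply/to_loc_ext => //; exists (v * u).
    by rewrite prime_idealrM negb_or pv.
  by rewrite -mulrA.
have [d Hd] := regular_approx noethB iNN iL regL l.
have [b Hb] := fil_dense (d + l) c.
apply: (idealBr (fil_ideal _ l)); first by apply: fil_le Hb; rewrite leq_addl.
apply/fil_iota.
suff: ideal_add (ideal_ext tau (ideal_exp J l)) (ideal_exp [set` @loc_max A p] l) b.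
  apply: ideal_add_min => //; first exact: ideal_exp_ideal.
  apply: ideal_ext_min; first exact: ideal_exp_ideal.
  move=> a /(ideal_ext_exp tau); rewrite loc_maxE.
  by apply: ideal_exp_sub; apply: ideal_ext_sub.
apply: Hd; apply: ext_fil => //.
exists (sigma (y ^+ (T * l)) * c); first by rewrite -ext_sigma.
exists (- (sigma (y ^+ (T * l)) * (c - iota b))).
  apply: (idealN (fil_ideal _ _)); exact: (idealM _ (fil_ideal _ _)).
by rewrite mulrBr opprB addrC subrK rmorphM.
Qed.

End LocalCompletion.

(** * Krull's principal ideal and height theorems *)

Section DescendingChains.
Variables (R : comNzRingType) (n : set R).
Hypotheses (noethR : noetherian R) (locn : is_local n).
Implicit Types (D J K U V W : set R).

(** What finiteness of the length of [V / W] is used for. *)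
Definition dcc_between W V : Prop := forall D : nat -> set R,
  (forall i, is_ideal (D i)) -> (forall i, W `<=` D i) -> (forall i, D i `<=` V) ->
  (forall i, D i.+1 `<=` D i) -> exists k, forall j, D k `<=` D j.

Lemma dcc_sub W V W' V' : W `<=` W' -> V' `<=` V ->
  dcc_between W V -> dcc_between W' V'.
Proof.
move=> WW VV H D iD WD DV DS; apply: H => // i x.
  by move=> /WW/WD.
by move=> /DV/VV.
Qed.

(** By the modular law, a member of a descending chain is determined by its
    intersection with [V] and its sum with [V]. *)
Lemma dcc_trans W V U : is_ideal V -> dcc_between W V -> dcc_between V U ->
  W `<=` V -> V `<=` U -> is_ideal U -> dcc_between W U.
Proof.
move=> iV dWV dVU WV VU iU D iD WD DU DS.
have DS_le i j : (i <= j)%N -> D j `<=` D i.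
  move=> /subnK <-; elim: (j - i)%N => // k IH x /DS; exact: IH.
have [||||k1 H1] := dWV (fun i => D i `&` V).
- move=> i; split; first by split; [case: (iD i)|case: iV].
  by move=> a x y [Dx Vx] [Dy Vy]; split; [apply: (iD i).2|apply: iV.2].
- by move=> i x Wx; split; [apply: WD|apply: WV].
- by move=> i x [].
- by move=> i x [/DS].
have [||||k2 H2] := dVU (fun i => ideal_add (D i) V).
- by move=> i; apply: ideal_add_ideal.
- by move=> i; apply: ideal_addr.
- by move=> i; apply: ideal_add_min.
- move=> i; apply: ideal_add_min; first exact: ideal_add_ideal.
    by move=> x /DS; apply: ideal_addl.
  exact: ideal_addr.
exists (maxn k1 k2) => j x Dx.
have [y Dy [v Vv defx]] : ideal_add (D (maxn j (maxn k1 k2))) V x.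
  by apply: H2; apply: ideal_addl => //; apply: DS_le Dx; apply: leq_maxr.
have Dv : D (maxn k1 k2) v.
  rewrite (_ : v = x - y); last by rewrite -defx addrC addKr.
  by apply: idealB => //; apply: DS_le Dy; apply: leq_maxr.
have [Djv _] : (D j `&` V) v.
  by apply: H1; split => //; apply: DS_le Dv; apply: leq_maxl.
rewrite -defx; apply: idealD => //; apply: DS_le Dy; exact: leq_maxl.
Qed.

(** The quotient is at most a line over the residue field. *)
Lemma dcc_simple W v : is_ideal W -> (forall a, n a -> W (a * v)) ->
  dcc_between W (ideal_add W [set r * v | r in setT]).
Proof.
move=> iW nW D iD WD DV DS; have [_ _ Nu] := locn.
case: (pselect (exists i, D i `<=` W)) => [[i DW]|no].
  by exists i => j x /DW/WD.
exists 0%N => j; apply: subset_trans (DV 0%N) _; apply: ideal_add_min => //.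
suff Dv : D j v by move=> _ [r _ <-]; apply: idealM.
have [x [Dx nWx]] : exists x, D j x /\ ~ W x.
  apply: contrapT => H; apply: no; exists j => x Dx.
  by apply: contrapT => nWx; apply: H; exists x.
have [w Ww [_ [b _ <-] defx]] := DV j x Dx.
have [|b' bb'] := Nu b.
  by move=> nb; apply: nWx; rewrite -defx; apply: idealD => //; apply: nW.
rewrite -[v]mul1r -bb' [b * b']mulrC -mulrA; apply: idealM => //.
rewrite (_ : b * v = x - w); last by rewrite -defx addrC addKr.
by apply: idealB => //; apply: WD.
Qed.

Lemma dcc_gens W (s : seq R) : is_ideal W ->
  (forall a g, n a -> g \in s -> W (a * g)) ->
  dcc_between W (ideal_add W (ideal_span [set` s])).
Proof.
move=> iW; elim: s => [|g s IH] nW.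
  move=> D iD WD DV _; exists 0%N => j; apply: subset_trans (DV 0%N) _.
  apply: ideal_add_min => //; apply: ideal_span_min => //.
have iS := @ideal_span_ideal R [set` s].
have iWS : is_ideal (ideal_add W (ideal_span [set` s])) by apply: ideal_add_ideal.
have ig := principal_ideal g.
apply: (@dcc_sub W (ideal_add (ideal_add W (ideal_span [set` s]))
                   [set r * g | r in setT])) => //.
  have iWSg := ideal_add_ideal iWS ig.
  apply: ideal_add_min => //.
    by move=> x Wx; apply: ideal_addl => //; apply: ideal_addl.
  apply: ideal_span_min => // x /=; rewrite inE => /orP[/eqP->|xs].
    by apply: ideal_addr => //; exists 1 => //; rewrite mul1r.
  by apply: ideal_addl => //; apply: ideal_addr => //; apply: sub_ideal_span.
apply: (@dcc_trans _ (ideal_add W (ideal_span [set` s]))) => //.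
- by apply: IH => a h na hs; apply: nW => //; rewrite inE hs orbT.
- apply: dcc_simple => // a na; apply: ideal_addl => //; apply: nW => //.
  exact: mem_head.
- exact: ideal_addl.
- exact: ideal_addl.
- exact: ideal_add_ideal.
Qed.

Lemma dcc_power W k : is_ideal W -> ideal_exp n k `<=` W -> dcc_between W setT.
Proof.
move=> iW nkW; have iNk i := @ideal_exp_ideal R n i.
have iA i : is_ideal (ideal_add W (ideal_exp n i)) by apply: ideal_add_ideal.
suff: dcc_between (ideal_add W (ideal_exp n k)) setT.
  by apply: dcc_sub => //; apply: ideal_add_min.
elim: k {nkW} => [|k IH].
  by move=> D iD WD DV _; exists 0%N => j x _; apply: WD; apply: ideal_addr.
apply: (@dcc_trans _ (ideal_add W (ideal_exp n k))) => //; last first.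
  apply: ideal_add_min => //; first exact: ideal_addl.
  by move=> x /ideal_expS_sub; apply: ideal_addr.
have [s Es] := noethR (iNk k).
apply: (@dcc_sub (ideal_add W (ideal_exp n k.+1))
  (ideal_add (ideal_add W (ideal_exp n k.+1)) (ideal_span [set` s]))) => //.
  rewrite -Es; apply: ideal_add_min; first exact: ideal_add_ideal.
    by move=> x Wx; apply: ideal_addl => //; apply: ideal_addl.
  exact: ideal_addr.
apply: dcc_gens => // a g na gs; apply: ideal_addr => //.
have ng : ideal_exp n k g by rewrite Es; apply: sub_ideal_span.
exact: ideal_mulM.
Qed.

End DescendingChains.

Section PrincipalIdealTheorem.
Variable R : comNzRingType.
Hypothesis noethR : noetherian R.
Implicit Types (J K P Q T : set R).

(** If [b ^+ 2] is in [J] but [b] is not, both [(J : b)] and [J + (b)] are larger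
    than [J] and Noetherian induction applies to them; without such a [b] in [K],
    the ideal [J] contains [K]. *)
Lemma radical_power K J : is_ideal K -> is_ideal J -> K `<=` radical J ->
  exists k, ideal_exp K k `<=` J.
Proof.
move=> iK iJ; move: J iJ; apply: (noeth_ind noethR) => J iJ IH KJ.
case: (pselect (exists b, [/\ K b, ~ J b & J (b ^+ 2)])) => [[b [Kb nJb Jbb]]|no].
  pose J1 := [set x | J (b * x)].
  pose J2 := ideal_add J [set r * b | r in setT].
  have iJ1 : is_ideal J1.
    split; rewrite /J1 /=; first by rewrite mulr0; case: iJ.
    by move=> a x y Jx Jy; rewrite mulrDr mulrCA; apply: iJ.2.
  have ib := principal_ideal b.
  have J2b : J2 b by apply: ideal_addr => //; exists 1 => //; rewrite mul1r.
  have [|||k1 H1] := IH J1 iJ1; first by move=> x; apply: idealM.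
    by move=> /(_ b) H; apply: nJb; apply: H; rewrite /J1 /= -expr2.
    by move=> x /KJ[k Jx]; exists k; apply: idealM.
  have [|||k2 H2] := IH J2 (ideal_add_ideal iJ ib); first exact: ideal_addl.
    by move=> /(_ b J2b).
    by move=> x /KJ[k Jx]; exists k; apply: ideal_addl.
  exists (k1 + k2)%N; apply: subset_trans (@ideal_expD_sub R K k1 k2) _.
  apply: ideal_mul_min => // x _ /H1 J1x /H2[y Jy [_ [r _ <-] <-]].
  rewrite mulrDr; apply: idealD => //; first exact: idealM.
  by rewrite mulrCA; apply: idealM => //; rewrite mulrC.
exists 1%N; rewrite ideal_exp1 // => a Ka; have [k Jak] := KJ a Ka.
have: J (a ^+ (2 ^ k)).
  by rewrite -(subnK (ltnW (ltn_expl k (ltnSn 1)))) exprD; apply: idealM.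
elim: k {Jak} => // k IHk; rewrite expnSr exprM => Jak; apply: IHk.
apply: contrapT => nJ; apply: no; exists (a ^+ (2 ^ k)); split => //.
rewrite -[X in K (_ ^+ X)]prednK ?expn_gt0 // exprS; exact: is_idealMr.
Qed.

(** Let [S k] be the symbolic powers of [Q] modulo [P].  As [n] is nilpotent
    modulo [P + (x)], the ideals [S k + (x)] become constant; [x] is not in [Q], so
    it can be cancelled modulo [S k], and Nakayama's lemma makes [S k] constant
    too.  Then the [k]-th power of a member of [Q] is in all [S j], hence in [P] by
    Krull's intersection theorem at [Q]. *)
Lemma local_principal_ideal_theorem (n P Q : set R) x : is_local n ->
  is_prime P -> is_prime Q -> P `<=` Q -> Q `<=` n -> ~ (n `<=` Q) ->
  min_prime_over (ideal_adjoin P [:: x]) n -> Q `<=` P.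
Proof.
move=> locn pP pQ PQ Qn nQ [pn Pxn minn].
have [iN _ Nu] := locn; have [iP _ PM] := pP; have [iQ _ QM] := pQ.
have iPx := ideal_adjoin_ideal P [:: x].
have nx : ~ Q x.
  move=> Qx; apply: nQ; apply: minn => //.
  by apply: ideal_span_min => // y /= [/PQ//|]; rewrite inE => /eqP->.
have [N HN] : exists N, ideal_exp n N `<=` ideal_adjoin P [:: x].
  apply: radical_power => // a na.
  have [s [k [ns Jsa]]] := min_prime_nilp noethR iPx (And3 pn Pxn minn) na.
  have [t st] := Nu s ns; exists k.
  by rewrite -[a ^+ k]mul1r -st mulrAC; apply: (is_idealMr _ iPx).
have [q Eq] := prime_idealr_of pQ.
have qE a : a \notin q -> ~ Q a by rewrite -Eq => /negP.
pose tau := @to_loc R q.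
have locq := is_local_loc q; rewrite Eq in locq.
have iE K := @ideal_ext_ideal _ _ tau K.
pose mk k := ideal_exp (ideal_ext tau Q) k.
have imk k : is_ideal (mk k) := @ideal_exp_ideal _ (ideal_ext tau Q) k.
pose S k := tau @^-1` (ideal_add (ideal_ext tau P) (mk k)).
have iS k : is_ideal (S k) by apply: preimage_ideal; apply: ideal_add_ideal.
have PS k : P `<=` S k by move=> a Pa; apply: ideal_addl => //; apply: ideal_ext_mem.
have SS k : S k.+1 `<=` S k.
  move=> a; apply: ideal_add_min; first exact: ideal_add_ideal.
    exact: ideal_addl.
  by move=> b /ideal_expS_sub; apply: ideal_addr.
have ix := principal_ideal x.
pose D k := ideal_add (S k) [set r * x | r in setT].
have iD k : is_ideal (D k) by apply: ideal_add_ideal.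
have DS k : D k.+1 `<=` D k.
  apply: ideal_add_min => //; last exact: ideal_addr.
  by move=> a /SS; apply: ideal_addl.
have PxD k : ideal_adjoin P [:: x] `<=` D k.
  apply: ideal_span_min => // a /= [/PS ?|]; first exact: ideal_addl.
  rewrite inE => /eqP->; apply: ideal_addr => //; exists 1 => //; exact: mul1r.
have [k Hk] := dcc_power noethR locn iPx HN iD PxD (fun _ _ _ => I) DS.
have [t xt] : exists t, tau x * t = 1.
  by apply: to_loc_unit; apply/negP => qx; apply: nx; rewrite -Eq.
have SD_le i j : (i <= j)%N -> D j `<=` D i.
  move=> /subnK <-; elim: (j - i)%N => // l IHl a /DS; exact: IHl.
have Sstep j : (k <= j)%N -> S j `<=` S j.+1.
  move=> lekj; apply: (nakayama_sub noethR locn) => // a Sa.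
  have [b Sb [_ [r _ <-] defa]] : D j.+1 a.
    by apply: Hk; apply: (SD_le _ _ lekj); apply: ideal_addl.
  exists b => //; exists (r * x) => //; rewrite mulrC; apply: ideal_mulM.
    by apply: Pxn; apply: ideal_adjoin_mem; rewrite mem_head.
  have iA := ideal_add_ideal (iE P) (imk j).
  rewrite /S /= -[tau r]mulr1 -xt mulrA -rmorphM; apply: (is_idealMr _ iA).
  have -> : r * x = a - b by rewrite -defa addrC addKr.
  by apply: (idealB (iS j)) => //; apply: SS.
have Sconst j : S k `<=` S j.
  case: (leqP k j) => [/subnK <-|/ltnW].
    elim: (j - k)%N => // l IHl a /IHl; apply: Sstep; exact: leq_addl.
  move=> /subnK <-; elim: (k - j)%N => // l IHl a /SS; exact: IHl.
move=> a Qa; apply: (primeX (k := k) pP).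
have Sak : S k (a ^+ k).
  apply: ideal_addr => //; rewrite /mk /tau rmorphXn.
  by apply: ideal_expX; apply: (@ideal_ext_mem _ _ (@to_loc R q)).
have : ideal_ext tau P (tau (a ^+ k)).
  apply: (krull_intersection (noetherian_loc noethR) locq) => // j.
  exact: Sconst Sak.
by move=> /(to_loc_ext _ _ iP)[s /qE ns /PM[/PQ|]].
Qed.

End PrincipalIdealTheorem.

Section HeightTheorem.
Variable R : comNzRingType.
Hypothesis noethR : noetherian R.
Implicit Types (J K P Q T : set R).

(** Localizing at [T] reduces to the local case. *)
Lemma principal_ideal_theorem P Q T x : is_prime P -> is_prime Q ->
  P `<=` Q -> Q `<=` T -> ~ (T `<=` Q) ->
  min_prime_over (ideal_adjoin P [:: x]) T -> Q `<=` P.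
Proof.
move=> pP pQ PQ QT TQ [pT PxT minT].
have [q Eq] := prime_idealr_of pT.
have locT := is_local_loc q; rewrite Eq in locT.
have Tq V : V `<=` T -> V `<=` [set` q] by rewrite Eq.
have [pP' contP] := ext_prime_loc pP (Tq _ (subset_trans PQ QT)).
have [pQ' contQ] := ext_prime_loc pQ (Tq _ QT).
rewrite -contQ -contP.
suff QP : ideal_ext (@to_loc R q) Q `<=` ideal_ext (@to_loc R q) P by move=> a; apply: QP.
apply: (local_principal_ideal_theorem (@noetherian_loc _ q noethR) locT pP' pQ'
  (x := to_loc q x)).
- exact: ideal_ext_sub.
- exact: ideal_ext_sub.
- move=> TQ'; apply: TQ => a Ta; rewrite -contQ; apply: TQ'.
  exact: ideal_ext_mem.
split; first exact: local_prime.
  apply: ideal_span_min; first exact: ideal_ext_ideal.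
  move=> a /= [|]; first by apply: ideal_ext_sub => b /PQ/QT.
  rewrite inE => /eqP->; apply: ideal_ext_mem; apply: PxT.
  by apply: ideal_adjoin_mem; rewrite mem_head.
move=> V pV PxV VT; have [iV _ _] := pV; apply: ideal_ext_min => //.
suff: T `<=` @to_loc R q @^-1` V by [].
apply: minT; first exact: preimage_prime.
  apply: ideal_span_min; first exact: preimage_ideal.
  move=> a /= [Pa|].
    by apply: PxV; apply: ideal_adjoin_sub; apply: ideal_ext_mem.
  by rewrite inE => /eqP->; apply: PxV; apply: ideal_adjoin_mem; rewrite mem_head.
move=> a /= /VT; move: (a).
by have [_ contT] := ext_prime_loc pT (Tq _ (fun _ h => h)); rewrite -{2}contT.
Qed.

Fixpoint prime_chain l P T : Prop :=
  if l is l'.+1 then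
    is_prime P /\ exists P', [/\ P `<=` P', ~ (P' `<=` P) & prime_chain l' P' T]
  else is_prime P /\ P = T.

Lemma prime_chain_first l P T : prime_chain l P T -> is_prime P.
Proof. by case: l => [|l] []. Qed.

Lemma prime_chain_sub l P T : prime_chain l P T -> P `<=` T.
Proof.
elim: l P => [|l IH] P /=; first by move=> [_ ->].
by move=> [_ [P' [PP' _ /IH P'T]]] x /PP'/P'T.
Qed.

Lemma prime_chain_top l P T T' : is_prime T' -> T `<=` T' ->
  prime_chain l.+1 P T -> prime_chain l.+1 P T'.
Proof.
move=> pT' TT'; elim: l P => [|l IH] P [pP [P' [PP' P'P H]]]; split => //.
  move: H => [_ P'T]; exists T'; split => //.
    by move=> x /PP'; rewrite P'T; apply: TT'.
  by move=> T'P; apply: P'P => x; rewrite P'T => /TT'; apply: T'P.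
by exists P'; split => //; apply: IH.
Qed.

(** By the principal ideal theorem, a prime minimal over [P + (x)] is not two
    steps above [P]; this brings [x] down the chain, one member at a time. *)
Lemma prime_chain_push l P T x : prime_chain l.+1 P T -> T x ->
  exists P', [/\ P `<=` P', P' x & prime_chain l P' T].
Proof.
elim: l P => [|l IH] P [pP [P1 [PP1 P1P ch]]] Tx.
  by exists P1; split => //; case: ch => _ ->.
have [P2 [P12 P2x ch2]] := IH P1 ch Tx.
case: (pselect (P1 x)) => [P1x|nP1x]; first by exists P1; split.
have pP1 := prime_chain_first (l := l.+1) ch; have pP2 := prime_chain_first ch2.
have Px2 : ideal_adjoin P [:: x] `<=` P2.
  apply: ideal_span_min; first by case: pP2.
  by move=> y /= [/PP1/P12//|]; rewrite inE => /eqP->.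
have [P' minP' P'2] := min_prime_below noethR (ideal_adjoin_ideal _ _) pP2 Px2.
have [pP' PxP' _] := minP'.
have P'x : P' x by apply: PxP'; apply: ideal_adjoin_mem; rewrite mem_head.
exists P'; split => //; first by move=> y Py; apply: PxP'; apply: ideal_adjoin_sub.
split => //; exists P2; split => // P2P'; apply: P1P.
apply: (principal_ideal_theorem pP pP1 PP1 (T := P') _ _ minP') => [y /P12/P2P'//|].
by move=> P'P1; apply: nP1x; apply: P'P1.
Qed.

(** Krull's height theorem, by induction on the number of generators: once the
    second member of the chain contains the first generator, the rest of the
    chain needs only the other ones. *)
Lemma height_theorem (s : seq R) l P T T' : prime_chain l P T -> T `<=` T' ->
  min_prime_over (ideal_adjoin P s) T' -> (l <= size s)%N.
Proof.
elim: s l P T => [|x s IH] [//|l] P T ch TT' [pT' PsT' minT'].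
  have [pP [P1 [PP1 P1P /prime_chain_sub P1T]]] := ch; case: P1P => y /P1T/TT'.
  apply: minT' => //.
    apply: ideal_span_min; first by case: pP.
    by move=> z /= [].
  by move=> z Pz; apply: PsT'; apply: ideal_adjoin_sub.
have T'x : T' x by apply: PsT'; apply: ideal_adjoin_mem; rewrite mem_head.
have [P' [PP' P'x ch']] := prime_chain_push (prime_chain_top pT' TT' ch) T'x.
apply: (IH _ _ _ ch') => //; split => //.
  apply: ideal_span_min; first by case: pT'.
  move=> y /= [|ys]; first exact: prime_chain_sub ch' _.
  by apply: PsT'; apply: ideal_adjoin_mem; rewrite inE ys orbT.
move=> V pV PsV VT'; apply: minT' => //.
apply: ideal_span_min; first by case: pV.
move=> y /= [/PP' P'y|]; first by apply: PsV; apply: ideal_adjoin_sub.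
rewrite inE => /orP[/eqP->|ys]; apply: PsV; first exact: ideal_adjoin_sub.
exact: ideal_adjoin_mem.
Qed.

End HeightTheorem.

(** * Krull dimension of a quotient ring *)

Section NatSupremum.
Variable N : set nat.
Local Notation A := [set (n%:Z)%:E | n in N].

(** [supremum] falls back on its default value when a nonempty set has no
    supremum, so that the existence of one has to be proved. *)
Lemma nat_supremums : N !=set0 -> supremums A !=set0.
Proof.
move=> [n0 Nn0].
case: (pselect (exists m, forall n, N n -> (n <= m)%N)) => [[m Nm]|unb].
  have ex : exists n, `[< N n >] by exists n0; apply/asboolP.
  have bd n : `[< N n >] -> (n <= m)%N by move=> /asboolP/Nm.
  have [M /asboolP NM maxM] := ex_maxnP ex bd.
  exists (M%:Z)%:E; split; last by move=> y; apply; exists M.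
  by move=> _ [n Nn <-]; rewrite lee_fin lez_nat; apply: maxM; apply/asboolP.
exists +oo%E; split; first by move=> y _; rewrite leey.
move=> [r| |] uby //; last first.
  have : ((n0%:Z)%:E <= -oo :> \bar int)%E by apply: uby; exists n0.
  by rewrite leeNy_eq.
exfalso; apply: unb; exists `|r|%N => n Nn.
have : ((n%:Z)%:E <= r%:E :> \bar int)%E by apply: uby; exists n.
by rewrite lee_fin; lia.
Qed.

Lemma le_nat_supremum n : N n -> ((n%:Z)%:E <= supremum -oo A)%E.
Proof.
move=> Nn; apply: ge_supremum_Nmem; first by apply: nat_supremums; exists n.
by exists n.
Qed.

Lemma nat_supremum_le m : (forall n, N n -> (n <= m)%N) ->
  (supremum -oo A <= (m%:Z)%:E)%E.
Proof.
move=> Nm; rewrite /supremum; case: ifPn => [_|/set0P[_ [n Nn _]]].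
  by rewrite leNye.
have [|_ ] := @xgetPex _ -oo%E (supremums A); first by apply: nat_supremums; exists n.
by apply=> _ [k Nk <-]; rewrite lee_fin lez_nat; apply: Nm.
Qed.

End NatSupremum.

Section KrullDimension.
Variables (R : comNzRingType) (I : idealr R).
Local Notation pi := (\pi_({ideal_quot I}) : R -> {ideal_quot I}).

Lemma pi_surj (y : {ideal_quot I}) : exists x, pi x = y.
Proof. by exists (repr y); rewrite reprK. Qed.

Lemma pi_ker x : pi x = 0 -> x \in I.
Proof.
move=> px; rewrite -[x]subr0 Quotient.idealrBE; apply/eqP.
by rewrite -[LHS]/(pi x) px -(rmorph0 pi).
Qed.

Lemma prime_chain_fun (R' : comNzRingType) l (P T : set R') : prime_chain l P T ->
  exists u : nat -> set R', [/\ u 0%N = P, forall i, (i <= l)%N -> is_prime (u i) &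
    forall i, (i < l)%N -> u i `<` u i.+1].
Proof.
elim: l P => [|l IH] P /=.
  by move=> [pP PT]; exists (fun=> P); split => // -[].
move=> [pP [P' [PP' P'P /IH[u [u0 up us]]]]].
exists (fun i => if i is i'.+1 then u i' else P); split => //.
  by case=> [//|i]; rewrite ltnS; apply: up.
case=> [_|i]; last by rewrite ltnS; apply: us.
by rewrite u0.
Qed.

Lemma fun_prime_chain (R' : comNzRingType) l (u : nat -> set R') :
  (forall i, (i <= l)%N -> is_prime (u i)) ->
  (forall i, (i < l)%N -> u i `<` u i.+1) -> prime_chain l (u 0%N) (u l).
Proof.
elim: l u => [|l IH] u up us; first by split => //; apply: up.
split; first exact: up.
have [u01 u10] := us 0%N (ltn0Sn l).
exists (u 1%N); split => //.
by apply: (IH (fun i => u i.+1)) => i lei; [apply: up|apply: us].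
Qed.

Lemma krull_dim_ge l (P T : set R) : prime_chain l P T -> [set` I] `<=` P ->
  ((l%:Z)%:E <= krull_dim {ideal_quot I})%E.
Proof.
move=> /prime_chain_fun[u [u0 up us]] IP; apply: le_nat_supremum.
have u_le i j : (i <= j)%N -> (j <= l)%N -> u i `<=` u j.
  move=> /subnK <-; elim: (j - i)%N => [|k IH] lel; first exact: subset_refl.
  by move=> x /(IH (ltnW lel)); apply: (us _ lel).1.
have uI i : (i <= l)%N -> forall x, pi x = 0 -> u i x.
  by move=> lei x /pi_ker Ix; apply: (u_le 0%N) => //; rewrite u0; apply: IP.
have ex (i : 'I_l.+1) : exists p : prime_idealr {ideal_quot I}, [set` p] = pi @` u i.
  apply: prime_idealr_of; apply: (image_prime pi_surj); last exact: uI (ltn_ord i).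
  exact: up (ltn_ord i).
have [c Hc] := choice ex; exists c => i j ltij; rewrite !Hc.
have pre (k : 'I_l.+1) : pi @^-1` (pi @` u k) = u k.
  by apply: preimage_image_ideal (uI k (ltn_ord k)); case: (up k (ltn_ord k)).
split; first by move=> _ [x ux <-]; exists x => //; apply: (u_le i j (ltnW ltij) (ltn_ord j)).
move=> H; apply: (us i (leq_trans ltij (ltn_ord j))).2 => x ux.
rewrite -pre; apply: H; exists x => //.
exact: (u_le i.+1 j ltij (ltn_ord j)).
Qed.

Lemma krull_dim_le m : (forall l (P T : set R), prime_chain l P T ->
    [set` I] `<=` P -> (l <= m)%N) ->
  (krull_dim {ideal_quot I} <= (m%:Z)%:E)%E.
Proof.
move=> H; apply: nat_supremum_le => l [c Hc].
pose u i := pi @^-1` [set` c (inord i)].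
have uI : [set` I] `<=` u 0%N.
  move=> x Ix; rewrite /u /= (_ : pi x = 0) ?idealr0 //.
  by apply/eqP; rewrite -(rmorph0 pi) -Quotient.idealrBE subr0.
apply: (H l (u 0%N) (u l)) => //; apply: fun_prime_chain => i lei.
  by apply: preimage_prime; apply: prime_idealr_is_prime.
have [|le nle] := Hc (inord i) (inord i.+1).
  by rewrite !inordK // ltnS ltnW.
split=> [x|sub]; first exact: le.
by apply: nle => y; have [x <-] := pi_surj y; apply: sub.
Qed.

End KrullDimension.

(** * Quintasymptotic sequences *)

Section QuintSequences.
Variables (R : comNzRingType).
Hypothesis noethR : noetherian R.
Implicit Types (J P Q T : set R) (s : seq R).

(** Any minimal prime of [R] below [p] can be lifted to a witness. *)
Lemma min_prime_quint J (p : prime_idealr R) : is_ideal J ->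
  min_prime_over J [set` p] -> quint_prime J p.
Proof.
move=> iJ [pp Jp minp].
have [|z minz zp] := min_prime_below noethR (zero_ideal R) pp.
  by move=> x ->; apply: idealr0.
have iz : is_ideal z by case: minz => [[]].
apply: (quint_prime_of_min noethR iJ minz); split => //.
  by apply: ideal_add_min => //; case: pp.
move=> Q pQ JzQ Qp; apply: minp => // x Jx; apply: JzQ; exact: ideal_addl.
Qed.

Lemma prime_chain_rcons l P Q T : prime_chain l P Q -> is_prime T ->
  Q `<=` T -> ~ (T `<=` Q) -> prime_chain l.+1 P T.
Proof.
move=> + pT QT TQ; elim: l P => [|l IH] P.
  by move=> [pP PQ]; rewrite PQ in pP *; split=> //; exists T.
by move=> [pP [P' [PP' P'P /IH ch]]]; split => //; exists P'.
Qed.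

Lemma prime_chain_last l P T : prime_chain l P T -> is_prime T.
Proof.
elim: l P => [|l IH] P; first by move=> [pP <-].
by move=> [_ [P' [_ _ /IH]]].
Qed.

(** The minimal primes over [(J, x_1, .., x_i)] belong to [Q^*], hence avoid the
    next term of the sequence: each term costs one step in a chain of primes. *)
Lemma quint_seq_chain J s T : quint_seq J s -> is_prime T ->
  ideal_adjoin J s `<=` T -> exists2 P, J `<=` P & prime_chain (size s) P T.
Proof.
move=> [_ qs] pT; rewrite -{1}(take_size s).
suff H i : (i <= size s)%N -> forall U, is_prime U -> ideal_adjoin J (take i s) `<=` U ->
    exists2 P, J `<=` P & prime_chain i P U by exact: H.
elim: i => [|i IH] lei U pU JU.
  by exists U => // x Jx; apply: JU; apply: ideal_adjoin_sub.
have JJ : ideal_adjoin J (take i s) `<=` ideal_adjoin J (take i.+1 s).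
  apply: ideal_span_sub => x [Jx|xs]; first by left.
  by right; rewrite (take_nth 0 lei) /= mem_rcons inE; apply/orP; right.
have iJi := ideal_adjoin_ideal J (take i s).
have [Q minQ QU] := min_prime_below noethR iJi pU (subset_trans JJ JU).
have [pQ JQ _] := minQ; have [q Eq] := prime_idealr_of pQ.
have [P JP ch] := IH (ltnW lei) Q pQ JQ; exists P => //.
apply: (prime_chain_rcons ch) => // UQ.
have := qs i q lei; rewrite -Eq in minQ; move=> /(_ (min_prime_quint iJi minQ)).
move=> /negP; apply; suff: [set` q] s`_i by [].
rewrite Eq; apply: UQ; apply: JU; apply: ideal_adjoin_mem.
by rewrite (take_nth 0 lei) mem_rcons mem_head.
Qed.

(** A minimal prime over the proper ideal [(J, s)] belongs to its set [Q^*], so it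
    does not contain [y]. *)
Lemma quint_seq_rcons_notin J s y : quint_seq J s -> quint_seq J (rcons s y) ->
  ~ ideal_adjoin J s y.
Proof.
move=> [nT _] [_ qs] Jy; have iJs := ideal_adjoin_ideal J s.
have [|||P [pP JsP _]] := @prime_missing _ noethR (ideal_adjoin J s) [set 1] iJs.
- by [].
- by move=> a b -> ->; rewrite /= mulr1.
- by move=> a Ja a1; apply: nT; apply: ideal1 => //; rewrite -a1.
have [Q minQ _] := min_prime_below noethR iJs pP JsP.
have [pQ JQ _] := minQ; have [q Eq] := prime_idealr_of pQ.
have := qs (size s) q; rewrite size_rcons nth_rcons ltnn eqxx -cats1 take_size_cat //.
rewrite -Eq in minQ; move=> /(_ (leqnn _) (min_prime_quint iJs minQ)) /negP; apply.
by suff: [set` q] y by []; rewrite Eq; apply: JQ.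
Qed.

(** Otherwise some sequence could be extended for ever, and would generate a
    strictly increasing sequence of ideals. *)
Lemma maximal_quint_seq_exists J : is_ideal J -> J <> setT ->
  exists s, maximal_quint_seq J s.
Proof.
move=> iJ JT; apply: contrapT => no.
have q0 : quint_seq J [::].
  split=> // adjT; apply: JT; rewrite -adjT; apply/seteqP; split.
    exact: ideal_adjoin_sub.
  by apply: ideal_span_min => // x [].
have next (s : {s | quint_seq J s}) : {y | quint_seq J (rcons (sval s) y)}.
  apply: cid; apply: contrapT => H; apply: no; exists (sval s); split.
    exact: (svalP s).
  by move=> y qy; apply: H; exists y.
pose v := fix v n := if n is n'.+1 then
  exist (quint_seq J) _ (svalP (next (v n'))) else exist _ [::] q0.
have [|i|n Hn] := @noeth_chain _ noethR (fun n => ideal_adjoin J (sval (v n))).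
- by move=> i; apply: ideal_adjoin_ideal.
- apply: ideal_span_sub => x [Jx|xs]; first by left.
  by right; rewrite /= mem_rcons inE; apply/orP; right.
apply: (quint_seq_rcons_notin (svalP (v n)) (svalP (next (v n)))).
apply: (Hn n.+1); apply: ideal_adjoin_mem.
by rewrite /= mem_rcons mem_head.
Qed.

Lemma qacogd_maximal J : is_ideal J -> J <> setT ->
  exists2 s, maximal_quint_seq J s & size s = qacogd J.
Proof.
move=> iJ JT; have [s ms] := maximal_quint_seq_exists iJ JT.
suff: [set size s | s in maximal_quint_seq J] (qacogd J) by move=> [s' ? ?]; exists s'.
by apply: xgetPex; exists (size s); exists s.
Qed.

End QuintSequences.

(** * Maximal quintasymptotic sequences of a local ring *)

Section LocalRing.
Variables (R : comNzRingType) (m : idealr R).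
Hypotheses (noethR : noetherian R) (R_local : local_ring m).
Implicit Types (J : set R).

Lemma local_ring_is_local : is_local [set` m].
Proof.
have im := idealr_is_ideal m; split => //; first by rewrite /= idealr1.
move=> a nma; apply: contrapT => nu; apply: nma.
have [||K [iK nK aK] maxK] := @noeth_max _ noethR
  (fun K => [/\ is_ideal K, ~ K 1 & K a]).
- by move=> K [].
- exists [set r * a | r in setT]; split; first exact: principal_ideal.
    by move=> [r _ ra]; apply: nu; exists r; rewrite mulrC.
  by exists 1 => //; rewrite mul1r.
have [N EN] := idealr_of iK nK.
have maxN : maximal_ideal N.
  move=> L NL x Lx; suff: [set` N] x by [].
  rewrite EN; apply: (maxK [set` L]) => //; last by rewrite -EN.
  split; [exact: idealr_is_ideal|by rewrite /= idealr1|apply: NL].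
  by suff: [set` N] a by []; rewrite EN.
by rewrite /= -(R_local.2 N maxN); suff: [set` N] a by []; rewrite EN.
Qed.

Let locm := local_ring_is_local.

(** Otherwise an element of [m] regular modulo all powers of [(J, s)] away from
    [m] extends the sequence. *)
Lemma maximal_quint_seq_top J s : is_ideal J -> maximal_quint_seq J s ->
  exists2 p : prime_idealr R, [set` p] = [set` m] & quint_prime (ideal_adjoin J s) p.
Proof.
move=> iJ [[nT qs] maxs]; apply: contrapT => no.
have iJs := ideal_adjoin_ideal J s; have [im _ _] := locm.
have Jm : ideal_adjoin J s `<=` [set` m].
  by apply: local_sub => // J1; apply: nT; apply: ideal1.
have [y my Hy] := power_torsion_avoidance noethR iJs im.
apply: (maxs y); split.
  move=> adjT; suff: [set` m] 1 by rewrite /= idealr1.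
  have : ideal_adjoin J (rcons s y) 1 by rewrite adjT.
  apply: ideal_span_min => // x [Jx|]; first by apply: Jm; apply: ideal_adjoin_sub.
  rewrite /= mem_rcons inE => /orP[/eqP->//|xs].
  by apply: Jm; apply: ideal_adjoin_mem.
move=> i p; rewrite size_rcons ltnS leq_eqVlt => /orP[/eqP->|lti]; last first.
  by rewrite nth_rcons lti -cats1 takel_cat 1?ltnW //; apply: qs.
rewrite nth_rcons ltnn eqxx -cats1 take_size_cat // => qp.
apply: (regular_not_quint noethR iJs _ qp) => k a Jya.
have [ip p1 _] := prime_idealr_is_prime p.
have [t [mt npt]] : exists t, m t /\ t \notin p.
  apply: contrapT => H; apply: no; exists p => //; apply/seteqP; split.
    exact: local_sub.
  by move=> t mt /=; apply: contrapT => /negP npt; apply: H; exists t.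
have [N JN] := Hy k a Jya t mt; exists (t ^+ N) => //.
apply/negP => /(primeX (prime_idealr_is_prime p)) /=; exact/negP.
Qed.

(** [R] and its localization at [m] have the same completion, along which the
    witness [z] of [Q^*] is transported. *)
Lemma quint_prime_completion J (p : prime_idealr R) : is_ideal J ->
  [set` p] = [set` m] -> quint_prime J p ->
  exists2 z : set (completion m), min_prime_over [set 0] z &
    forall a, m a -> exists k,
      ideal_add (ideal_ext (to_completion m) J) z (to_completion m a ^+ k).
Proof.
move=> iJ Epm [w minw rad]; have [im _ mu] := locm.
have [||| phi [phiE phi_surj phi_inj]] :=
    @completion_map R (localization p) (@to_loc R p) m (@loc_max R p).
- by move=> k x /(ideal_ext_exp (@to_loc R p)); rewrite loc_maxE Epm.
- move=> k x; rewrite loc_maxE => /ideal_exp_ext.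
  have imk := @ideal_exp_ideal R [set` m] k.
  rewrite Epm => /(to_loc_ext _ _ imk)[s ps].
  have [|t st] := mu s; first by rewrite -Epm; apply/negP.
  by move=> /(idealM t imk); rewrite mulrA [t * s]mulrC st mul1r.
- move=> x; have [a [s [t [ps st ->]]]] := loc_frac x.
  have [|s' ss'] := mu s; first by rewrite -Epm; apply/negP.
  exists (a * s'); rewrite rmorphM; congr (_ * _).
  by rewrite -[LHS]mulr1 -st mulrA -rmorphM mulrC [s' * s]mulrC ss' rmorph1 mulr1.
have pw := prime_idealr_is_prime w; have [iw _ _] := pw.
exists (phi @^-1` [set` w]).
  split; first exact: preimage_prime.
    by move=> x -> /=; rewrite rmorph0 idealr0.
  move=> Q pQ _ Qw; have [iQ _ _] := pQ.
  have kerQ x : phi x = 0 -> Q x by move=> /phi_inj->; case: iQ.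
  have [v Ev] := prime_idealr_of (image_prime phi_surj pQ kerQ).
  rewrite -(preimage_image_ideal iQ kerQ) -Ev => x /=; apply: minw => y vy.
  have : [set` v] y by [].
  by rewrite Ev => -[u Qu <-]; apply: Qw.
move=> a ma.
have : ideal_ext (to_loc_completion p) [set` p] (to_loc_completion p a).
  by apply: ideal_ext_mem; rewrite Epm.
rewrite -rad => -[k [x Jx [y wy defak]]]; exists k.
have Jphi : ideal_ext (to_loc_completion p) J `<=` phi @` ideal_ext (to_completion m) J.
  apply: ideal_ext_min; first by apply: image_ideal => //; apply: ideal_ext_ideal.
  move=> b Jb; exists (to_completion m b); first exact: ideal_ext_mem.
  exact: phiE.
have [u Ju Eu] := Jphi x Jx; exists u => //.
exists (to_completion m a ^+ k - u); last by rewrite addrC subrK.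
rewrite /= rmorphB rmorphXn phiE Eu -[X in X ^+ k]/(to_loc_completion p a).
by rewrite -defak addrC addKr.
Qed.

(** Modulo [q], the images of the terms of [s] generate an ideal primary to the
    maximal ideal, so the height theorem bounds the dimension. *)
Lemma maximal_quint_seq_dim J s : is_ideal J -> maximal_quint_seq J s ->
  exists2 q : prime_idealr (completion m),
    quint_prime (ideal_ext (to_completion m) J) q &
    (krull_dim {ideal_quot q} <= ((size s)%:Z)%:E)%E.
Proof.
move=> iJ ms; have [p Epm qp] := maximal_quint_seq_top iJ ms.
have iJs := ideal_adjoin_ideal J s.
have [z minz Hz] := quint_prime_completion iJs Epm qp.
pose A := completion m; pose iota := to_completion m.
have noethA : noetherian A := noetherian_completion noethR.
have locA := is_local_completion locm.
have [pz _ _] := minz; have [iz z1 _] := pz.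
have iE K := @ideal_ext_ideal _ _ iota K.
have Jsm : ideal_adjoin J s `<=` [set` m].
  by apply: local_sub => // Js1; have [[nT _] _] := ms; apply: nT; apply: ideal1.
have Jm : J `<=` [set` m] by move=> x Jx; apply: Jsm; apply: ideal_adjoin_sub.
have JzM : ideal_add (ideal_ext iota J) z `<=` @fil R m 1.
  apply: ideal_add_min; first exact: fil_ideal.
    by rewrite fil1E //; apply: ideal_ext_sub.
  exact: local_sub.
have iJz := ideal_add_ideal (iE J) iz.
have [Q minQ QM] := min_prime_below noethA iJz (local_prime locA) JzM.
have [pQ JzQ _] := minQ; have [q Eq] := prime_idealr_of pQ; exists q.
  by apply: (quint_prime_of_min noethA (iE J) minz); rewrite Eq.
apply: krull_dim_le => l P T ch qP; rewrite Eq in qP.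
have pP := prime_chain_first ch; have [iP P1 _] := pP.
have adj_sub V : is_ideal V -> ideal_add (ideal_ext iota J) z `<=` V ->
    (forall x, x \in s -> V (iota x)) ->
    forall a, m a -> exists k, V (iota a ^+ k).
  move=> iV JzV sV a ma; have [k Hk] := Hz a ma; exists k; move: Hk.
  apply: ideal_add_min => //; last by move=> x zx; apply: JzV; apply: ideal_addr.
  apply: ideal_ext_min => //.
  suff: ideal_adjoin J s `<=` iota @^-1` V by [].
  apply: ideal_span_min; first exact: preimage_ideal.
  move=> x [Jx|xs]; last exact: sV.
  by apply: JzV; apply: ideal_addl => //; apply: ideal_ext_mem.
rewrite -(size_map iota s).
have PM : P `<=` @fil R m 1 by apply: local_sub.
have TM : T `<=` @fil R m 1.
  have pT := prime_chain_last ch; have [iT T1 _] := pT; exact: local_sub.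
apply: (height_theorem noethA ch TM); split; first exact: local_prime.
  apply: ideal_span_min; first exact: fil_ideal.
  move=> x [/PM//|/mapP[y ys ->]]; rewrite fil1E //; apply: ideal_ext_mem.
  by apply: Jsm; apply: ideal_adjoin_mem.
move=> V pV PsV _; have [iV _ _] := pV; rewrite fil1E //.
apply: ideal_ext_min => // a ma; have [||k Vk] := adj_sub V iV _ _ a ma.
- by move=> x /JzQ/qP Px; apply: PsV; apply: ideal_adjoin_sub.
- by move=> x xs; apply: PsV; apply: ideal_adjoin_mem; apply: map_f.
exact: primeX Vk.
Qed.

End LocalRing.

Theorem theorem3p4 (R : comNzRingType) (m I : idealr R)
    (R_noetherian : noetherian R) (R_local : local_ring m) :
  (((qacogd [set` I])%:Z)%:E <= krull_dim {ideal_quot I})%E /\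
  (exists2 d : \bar int,
     is_min [set d | exists2 q : prime_idealr (completion m),
                       quint_prime (ideal_ext (to_completion m) [set` I]) q &
                       d = krull_dim {ideal_quot q}] d &
     (d <= ((qacogd [set` I])%:Z)%:E)%E).
Proof.
have iI := idealr_is_ideal I.
have IT : [set` I] <> setT.
  move=> IT; have : [set` I] 1 by rewrite IT.
  by rewrite /= idealr1.
have locm := local_ring_is_local R_noetherian R_local.
have [s ms <-] := qacogd_maximal R_noetherian iI IT; have [qs _] := ms.
split.
  have [|P IP ch] := quint_seq_chain R_noetherian qs (local_prime locm).
    apply: local_sub => //; first exact: ideal_adjoin_ideal.
    by move=> J1; have [nT _] := qs; apply: nT; apply: ideal1 => //; apply: ideal_adjoin_ideal.
  exact: krull_dim_ge ch IP.
have [q0 Qq0 dim_q0] := maximal_quint_seq_dim R_noetherian R_local iI ms.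
set D := [set d | _].
have D_ge0 d : D d -> (0 <= d)%E.
  move=> [q _ ->]; have pq := prime_idealr_is_prime q.
  by apply: (@krull_dim_ge _ q 0 [set` q] [set` q]).
have Dq0 : D (krull_dim {ideal_quot q0}) by exists q0.
have natE d : (0 <= d)%E -> (d < +oo)%E -> exists k : nat, d = ((k%:Z)%:E)%E.
  by case: d => // -[k|k] // _ _; exists k.
have [k0 Ek0] := natE _ (D_ge0 _ Dq0) (le_lt_trans dim_q0 (ltry _)).
have exk : exists k : nat, `[< D ((k%:Z)%:E)%E >] by exists k0; apply/asboolP; rewrite -Ek0.
(* no dimension is negative and one is finite: the minimum is a natural number *)
have [k /asboolP Dk mink] := ex_minnP exk.
exists ((k%:Z)%:E)%E.
  split => // d Dd; have [|ltd] := leP +oo%E d; first by rewrite leye_eq => /eqP->; rewrite leey.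
  have [k' Ek'] := natE _ (D_ge0 _ Dd) ltd; rewrite Ek' lee_fin lez_nat; apply: mink.
  by apply/asboolP; rewrite -Ek'.
apply: le_trans dim_q0; rewrite Ek0 lee_fin lez_nat; apply: mink.
by apply/asboolP; rewrite -Ek0.
Qed.
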